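(* Let $k$ be a field of characteristic $2$. Let $Q$ be the quiver with four vertices $1,2,3,4$ and exactly three arrows: a loop $\gamma\colon1\to1$, an arrow $\alpha\colon1\to2$ and an arrow $\beta\colon2\to1$ (so the vertices $3$ and $4$ are isolated). Then the basic algebra of $kM(2,2)$ is isomorphic to $kQ/I$, where $I$ is the ideal given by the relations $\alpha\beta=\gamma\beta=\gamma^2=\alpha\gamma=0$. Thus $kM(2,2)$ is Morita equivalent to a string algebra of infinite representation type.
   Context: $M(2,2)$ is the multiplicative monoid of $2\times2$ matrices over $\mathbb F_2$ and $kM(2,2)$ its monoid algebra. The path algebra $kQ$ has basis the directed paths in $Q$ (including an empty path at each vertex), with product given by concatenation, undefined concatenations being $0$; paths are composed from right to left, so $\alpha\beta$ is the path that first traverses $\beta$ and then $\alpha$. The basic algebra of a finite dimensional algebra $A$ is $eAe$, where $e=\varepsilon_1+\cdots+\varepsilon_t$ for a decomposition $1=\varepsilon_1+\cdots+\varepsilon_s$ into orthogonal primitive idempotents in which $\varepsilon_1,\ldots,\varepsilon_t$ are pairwise nonconjugate and represent all conjugacy classes of primitive idempotents; it is Morita equivalent to $A$ and well defined up to isomorphism. A string algebra is an algebra $kQ/I$ with $Q$ a finite quiver and $I$ an admissible ideal generated by paths such that each vertex is the source of at most two arrows and the target of at most two arrows, and for each arrow $\delta$ there is at most one arrow $\epsilon$ with $\epsilon\delta$ a path not in $I$ and at most one arrow $\epsilon'$ with $\delta\epsilon'$ a path not in $I$. A finite dimensional algebra has infinite representation type if it has infinitely many isomorphism classes of finite dimensional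 indecomposable modules. *)

(* Defs.v *)
From HB Require Import structures.
From mathcomp Require Import all_boot all_algebra.
From mathcomp Require Import finmap boolp.
From mathcomp Require Import monalg.

Set Implicit Arguments.
Unset Strict Implicit.
Unset Printing Implicit Defensive.

Import GRing.Theory.

Local Open Scope ring_scope.

#[short(type="finMonoidType")]
HB.structure Definition FinMonoid := {M of monoid.Monoid M & Finite M}.

Section MonoidAlgebra.
Variables (k : fieldType) (M : finMonoidType).

Definition monoid_alg : Type := {ffun M -> k^o}.

HB.instance Definition _ := GRing.Lmodule.on monoid_alg.

Implicit Types x y z : monoid_alg.

Definition monoid_alg_one : monoid_alg := [ffun m => (m == 1%g)%:R].
Definition monoid_alg_mul x y : monoid_alg :=
  [ffun m => \sum_(p : M * M | (p.1 * p.2)%g == m) x p.1 * y p.2].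

Let mulE x y m :
  monoid_alg_mul x y m = \sum_a \sum_b x a * y b * ((a * b)%g == m)%:R.
Proof.
rewrite ffunE pair_bigA big_mkcond; apply: eq_bigr => p _ /=.
by case: eqP; rewrite ?mulr1 ?mulr0.
Qed.

Let mul_sum x y (g : M -> k) :
  \sum_d monoid_alg_mul x y d * g d = \sum_a \sum_b x a * y b * g (a * b)%g.
Proof.
rewrite pair_bigA (partition_big (fun p => (p.1 * p.2)%g) xpredT) //=.
apply: eq_bigr => d _; rewrite ffunE mulr_suml.
by apply: eq_bigr => p /eqP->.
Qed.

Let mulA : associative monoid_alg_mul.
Proof.
move=> x y z; apply/ffunP=> m.
transitivity (\sum_a \sum_b \sum_c
    x a * y b * z c * ((a * b * c)%g == m)%:R).
  rewrite mulE; apply: eq_bigr => a _.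
  under eq_bigr do rewrite -mulrA; rewrite -mulr_sumr mul_sum mulr_sumr.
  apply: eq_bigr => b _; rewrite mulr_sumr; apply: eq_bigr => c _.
  by rewrite !mulrA monoid.mulgA.
rewrite mulE.
under [RHS]eq_bigr do (under eq_bigr do rewrite -mulrA; rewrite -mulr_sumr).
rewrite mul_sum; apply: eq_bigr => a _; apply: eq_bigr => b _.
by rewrite mulr_sumr; apply: eq_bigr => c _; rewrite mulrA.
Qed.

Let mul1x : left_id monoid_alg_one monoid_alg_mul.
Proof.
move=> x; apply/ffunP=> m; rewrite mulE (bigD1 1%g) //= [X in _ + X]big1.
  rewrite addr0 (bigD1 m) //= monoid.mul1g eqxx ffunE eqxx mul1r mulr1.
  by rewrite big1 ?addr0 // => b /negPf; rewrite monoid.mul1g => ->; rewrite mulr0.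
move=> a /negPf a1; rewrite big1 // => b _.
by rewrite ffunE a1 !mul0r.
Qed.

Let mulx1 : right_id monoid_alg_one monoid_alg_mul.
Proof.
move=> x; apply/ffunP=> m; rewrite mulE exchange_big (bigD1 1%g) //=.
rewrite [X in _ + X]big1.
  rewrite addr0 (bigD1 m) //= monoid.mulg1 eqxx ffunE eqxx !mulr1.
  by rewrite big1 ?addr0 // => b /negPf; rewrite monoid.mulg1 => ->; rewrite mulr0.
move=> a /negPf a1; rewrite big1 // => b _.
by rewrite ffunE a1 mulr0 mul0r.
Qed.

Let mulDl : left_distributive monoid_alg_mul +%R.
Proof.
move=> x y z; apply/ffunP=> m; rewrite !ffunE -big_split.
by apply: eq_bigr => p _; rewrite ffunE mulrDl.
Qed.

Let mulDr : right_distributive monoid_alg_mul +%R.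
Proof.
move=> x y z; apply/ffunP=> m; rewrite !ffunE -big_split.
by apply: eq_bigr => p _; rewrite ffunE mulrDr.
Qed.

Let one_neq0 : monoid_alg_one != 0.
Proof.
by apply/eqP=> /ffunP/(_ 1%g); rewrite !ffunE eqxx => /eqP; rewrite oner_eq0.
Qed.

HB.instance Definition _ := GRing.Zmodule_isNzRing.Build monoid_alg
  mulA mul1x mulx1 mulDl mulDr one_neq0.

Let scaleAl (c : k) x y : c *: (x * y) = (c *: x) * y.
Proof.
apply/ffunP=> m; rewrite !ffunE scaler_sumr; apply: eq_bigr => p _.
by rewrite ffunE scalerAl.
Qed.

HB.instance Definition _ := GRing.Lmodule_isLalgebra.Build k monoid_alg scaleAl.

Let scaleAr (c : k) x y : c *: (x * y) = x * (c *: y).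
Proof.
apply/ffunP=> m; rewrite !ffunE scaler_sumr; apply: eq_bigr => p _.
by rewrite ffunE scalerAr.
Qed.

HB.instance Definition _ := GRing.Lalgebra_isAlgebra.Build k monoid_alg scaleAr.

End MonoidAlgebra.

Definition M22 : Type := 'M['F_2]_2.
HB.instance Definition _ := Finite.on M22.
HB.instance Definition _ := monoid.isMonoid.Build M22
  (@mulmxA _ 2 2 2 2) (@mul1mx _ 2 2) (@mulmx1 _ 2 2).

Definition alg_iso (k : fieldType) (A B : algType k) : Prop :=
  exists f : {lrmorphism A -> B}, bijective f.

Definition two_sided (A : nzRingType) (I : A -> Prop) : Prop :=
  [/\ I 0, forall x y, I x -> I y -> I (x + y),
      forall a x, I x -> I (a * x) & forall a x, I x -> I (x * a)].

Definition gen_ideal (A : nzRingType) (S : A -> Prop) (x : A) : Prop :=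
  forall I : A -> Prop, two_sided I -> (forall s, S s -> I s) -> I x.

(* Properness is required because an [algType] satisfies [1 != 0]. *)
Record proper_ideal (A : nzRingType) := ProperIdeal {
  ideal_mem :> A -> Prop;
  ideal_two_sided : two_sided ideal_mem;
  ideal_proper : ~ ideal_mem 1 }.

Lemma gen_two_sided (A : nzRingType) (S : A -> Prop) : two_sided (gen_ideal S).
Proof.
split=> [|x y gx gy|a x gx|a x gx] I idI SI; case: (idI) => I0 ID Il Ir.
- by [].
- by apply: ID; [apply: gx | apply: gy].
- by apply: Il; apply: gx.
- by apply: Ir; apply: gx.
Qed.

Section Quotient.
Variables (k : fieldType) (A : algType k) (I : proper_ideal A).
Implicit Types x y z : A.

Let I0 : I 0. Proof. by case: (ideal_two_sided I). Qed.
Let ID x y : I x -> I y -> I (x + y).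
Proof. by case: (ideal_two_sided I) => _ h _ _; apply: h. Qed.
Let Il a x : I x -> I (a * x).
Proof. by case: (ideal_two_sided I) => _ _ h _; apply: h. Qed.
Let Ir a x : I x -> I (x * a).
Proof. by case: (ideal_two_sided I) => _ _ _ h; apply: h. Qed.
Let IN x : I x -> I (- x).
Proof. by move=> Ix; rewrite -mulN1r; apply: Il. Qed.
Let IZ (c : k) x : I x -> I (c *: x).
Proof. by move=> Ix; rewrite -[x]mul1r scalerAl; apply: Il. Qed.

Definition ideal_eqv x y : bool := `[< I (x - y) >].

Let eqv_refl : reflexive ideal_eqv.
Proof. by move=> x; apply/asboolP; rewrite subrr. Qed.
Let eqv_sym : symmetric ideal_eqv.
Proof.
by move=> x y; apply/asboolP/asboolP => /IN; rewrite opprB.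
Qed.
Let eqv_trans : transitive ideal_eqv.
Proof.
move=> y x z /asboolP xy /asboolP yz; apply/asboolP.
by have := ID xy yz; rewrite addrA subrK.
Qed.

Canonical ideal_eqv_rel := EquivRel ideal_eqv eqv_refl eqv_sym eqv_trans.

Definition quot_alg : Type := {eq_quot ideal_eqv}%qT.

HB.instance Definition _ := Choice.on quot_alg.

Definition quot_pi (x : A) : quot_alg := (\pi_({eq_quot ideal_eqv}) x)%qT.

Lemma quot_piP x y : quot_pi x = quot_pi y <-> I (x - y).
Proof.
split=> [/eqP|Ixy]; first by rewrite /quot_pi eqmodE => /asboolP.
by apply/eqP; rewrite /quot_pi eqmodE; apply/asboolP.
Qed.

Lemma quot_pi_surj (q : quot_alg) : {x | q = quot_pi x}.
Proof. by exists (repr q); rewrite /quot_pi reprK. Qed.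

Let rep (q : quot_alg) : A := sval (quot_pi_surj q).
Let repK q : quot_pi (rep q) = q.
Proof. by rewrite /rep; case: (quot_pi_surj q). Qed.
Let repP x : I (rep (quot_pi x) - x).
Proof. by apply/quot_piP; rewrite repK. Qed.

Definition quot_add p q := quot_pi (rep p + rep q).
Definition quot_opp p := quot_pi (- rep p).
Definition quot_mul p q := quot_pi (rep p * rep q).
Definition quot_scale (c : k) p := quot_pi (c *: rep p).

Let addE x y : quot_add (quot_pi x) (quot_pi y) = quot_pi (x + y).
Proof. by apply/quot_piP; rewrite opprD addrACA; apply: ID; apply: repP. Qed.
Let oppE x : quot_opp (quot_pi x) = quot_pi (- x).
Proof. by apply/quot_piP; rewrite -opprD; apply/IN/repP. Qed.
Let mulE x y : quot_mul (quot_pi x) (quot_pi y) = quot_pi (x * y).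
Proof.
apply/quot_piP; rewrite -[_ - _](subrKA (x * rep (quot_pi y))).
rewrite -mulrBl -mulrBr; apply: ID; [exact/Ir/repP | exact/Il/repP].
Qed.
Let scaleE c x : quot_scale c (quot_pi x) = quot_pi (c *: x).
Proof. by apply/quot_piP; rewrite -scalerBr; apply/IZ/repP. Qed.

Let surj := quot_pi_surj.

Let addA : associative quot_add.
Proof.
move=> p q r; case: (surj p) (surj q) (surj r) => [x ->] [y ->] [z ->].
by rewrite !addE addrA.
Qed.
Let addC : commutative quot_add.
Proof.
by move=> p q; case: (surj p) (surj q) => [x ->] [y ->]; rewrite !addE addrC.
Qed.
Let add0 : left_id (quot_pi 0) quot_add.
Proof. by move=> p; case: (surj p) => [x ->]; rewrite addE add0r. Qed.
Let addN : left_inverse (quot_pi 0) quot_opp quot_add.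
Proof. by move=> p; case: (surj p) => [x ->]; rewrite oppE addE addNr. Qed.

HB.instance Definition _ := GRing.isZmodule.Build quot_alg addA addC add0 addN.

Let mulA : associative quot_mul.
Proof.
move=> p q r; case: (surj p) (surj q) (surj r) => [x ->] [y ->] [z ->].
by rewrite !mulE mulrA.
Qed.
Let mul1q : left_id (quot_pi 1) quot_mul.
Proof. by move=> p; case: (surj p) => [x ->]; rewrite mulE mul1r. Qed.
Let mulq1 : right_id (quot_pi 1) quot_mul.
Proof. by move=> p; case: (surj p) => [x ->]; rewrite mulE mulr1. Qed.
Let mulDl : left_distributive quot_mul quot_add.
Proof.
move=> p q r; case: (surj p) (surj q) (surj r) => [x ->] [y ->] [z ->].
by rewrite !(addE, mulE) mulrDl.
Qed.
Let mulDr : right_distributive quot_mul quot_add.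
Proof.
move=> p q r; case: (surj p) (surj q) (surj r) => [x ->] [y ->] [z ->].
by rewrite !(addE, mulE) mulrDr.
Qed.
Let one_neq0 : quot_pi 1 != quot_pi 0.
Proof.
by apply/eqP => /quot_piP; rewrite subr0; apply: ideal_proper.
Qed.

HB.instance Definition _ := GRing.Zmodule_isNzRing.Build quot_alg
  mulA mul1q mulq1 mulDl mulDr one_neq0.

Let scaleA c d p : quot_scale c (quot_scale d p) = quot_scale (c * d) p.
Proof. by case: (surj p) => [x ->]; rewrite !scaleE scalerA. Qed.
Let scale1 : left_id 1 quot_scale.
Proof. by move=> p; case: (surj p) => [x ->]; rewrite scaleE scale1r. Qed.
Let scaleDr : right_distributive quot_scale quot_add.
Proof.
move=> c p q; case: (surj p) (surj q) => [x ->] [y ->].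
by rewrite !(addE, scaleE) scalerDr.
Qed.
Let scaleDl p : {morph quot_scale^~ p : c d / c + d >-> quot_add c d}.
Proof.
by move=> c d; case: (surj p) => [x ->]; rewrite !(addE, scaleE) scalerDl.
Qed.

HB.instance Definition _ := GRing.Zmodule_isLmodule.Build k quot_alg
  scaleA scale1 scaleDr scaleDl.

Let scaleAl (c : k) (p q : quot_alg) : c *: (p * q) = (c *: p) * q.
Proof.
case: (surj p) (surj q) => [x ->] [y ->].
change (quot_scale c (quot_mul (quot_pi x) (quot_pi y)) =
        quot_mul (quot_scale c (quot_pi x)) (quot_pi y)).
by rewrite !(mulE, scaleE) scalerAl.
Qed.

HB.instance Definition _ := GRing.Lmodule_isLalgebra.Build k quot_alg scaleAl.

Let scaleAr (c : k) (p q : quot_alg) : c *: (p * q) = p * (c *: q).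
Proof.
case: (surj p) (surj q) => [x ->] [y ->].
change (quot_scale c (quot_mul (quot_pi x) (quot_pi y)) =
        quot_mul (quot_pi x) (quot_scale c (quot_pi y))).
by rewrite !(mulE, scaleE) scalerAr.
Qed.

HB.instance Definition _ := GRing.Lalgebra_isAlgebra.Build k quot_alg scaleAr.

Lemma quot_pi_is_linear : linear quot_pi.
Proof.
move=> c x y; change (quot_pi (c *: x + y) =
  quot_add (quot_scale c (quot_pi x)) (quot_pi y)).
by rewrite !(addE, scaleE).
Qed.
HB.instance Definition _ :=
  GRing.isLinear.Build k A quot_alg _ quot_pi quot_pi_is_linear.

Lemma quot_pi_is_monoid_morphism : monoid_morphism quot_pi.
Proof.
by split=> // x y; symmetry; apply: mulE.
Qed.
HB.instance Definition _ :=
  GRing.isMonoidMorphism.Build A quot_alg quot_pi quot_pi_is_monoid_morphism.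

End Quotient.

Section Idempotents.
Variable A : nzRingType.

Definition primitive_idem (e : A) : Prop :=
  [/\ e != 0, e * e = e &
      forall a b, a * a = a -> b * b = b -> a * b = 0 -> b * a = 0 ->
        e = a + b -> a = 0 \/ b = 0].

Definition conj_idem (e f : A) : Prop :=
  exists u v, [/\ u * v = 1, v * u = 1 & f = u * e * v].

Definition basic_idem (e : A) : Prop :=
  exists (s t : nat) (eps : 'I_s -> A),
    [/\ (t <= s)%N,
        \sum_i eps i = 1,
        forall i, primitive_idem (eps i) &
        forall i j, i != j -> eps i * eps j = 0] /\
    [/\ forall i j : 'I_s, (i < t)%N -> (j < t)%N ->
          conj_idem (eps i) (eps j) -> i = j,
        forall f, primitive_idem f ->
          exists2 i : 'I_s, (i < t)%N & conj_idem (eps i) f &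
        e = \sum_(i < s | (i < t)%N) eps i].

(* Nonzero idempotents, so that the ring [eAe] is nontrivial. *)
Record nzidem := NzIdem {
  idem_val : A;
  idem_mul : idem_val * idem_val = idem_val;
  idem_neq0 : idem_val != 0 }.

End Idempotents.

Section Corner.
Variables (k : fieldType) (A : algType k) (e : nzidem A).

Local Notation ev := (idem_val e : A).

Definition in_corner : {pred A} := [pred x : A | ev * x * ev == x].

Definition corner : Type := {x : A | in_corner x}.

HB.instance Definition _ := SubChoice.on corner.

Let ee : ev * ev = ev := idem_mul e.

Let corner_submod : submod_closed in_corner.
Proof.
split=> [|c x y /eqP hx /eqP hy]; first by rewrite inE mulr0 mul0r.
by rewrite inE mulrDr mulrDl -scalerAr -scalerAl hx hy.
Qed.
HB.instance Definition _ :=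
  GRing.isSubmodClosed.Build k A in_corner corner_submod.
HB.instance Definition _ := [SubChoice_isSubLmodule of corner by <:].

Lemma corner_mull (x : corner) : ev * val x = val x.
Proof. by case: x => x /= /eqP <-; rewrite !mulrA ee. Qed.
Lemma corner_mulr (x : corner) : val x * ev = val x.
Proof. by case: x => x /= /eqP <-; rewrite -!mulrA ee. Qed.

Let one_subproof : in_corner ev.
Proof. by rewrite /in_corner /= !ee. Qed.
Let mul_subproof (x y : corner) : in_corner (val x * val y).
Proof. by rewrite /in_corner /= mulrA corner_mull -mulrA corner_mulr. Qed.

Definition corner_one : corner := Sub ev one_subproof.
Definition corner_mul (x y : corner) : corner :=
  Sub (val x * val y) (mul_subproof x y).

Let mulA : associative corner_mul.
Proof. by move=> x y z; apply: val_inj; rewrite /= mulrA. Qed.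
Let mul1x : left_id corner_one corner_mul.
Proof. by move=> x; apply: val_inj; rewrite /= corner_mull. Qed.
Let mulx1 : right_id corner_one corner_mul.
Proof. by move=> x; apply: val_inj; rewrite /= corner_mulr. Qed.
Let mulDl : left_distributive corner_mul +%R.
Proof. by move=> x y z; apply: val_inj; rewrite /= mulrDl. Qed.
Let mulDr : right_distributive corner_mul +%R.
Proof. by move=> x y z; apply: val_inj; rewrite /= mulrDr. Qed.
Let one_neq0 : corner_one != 0.
Proof. by rewrite -val_eqE /= idem_neq0. Qed.

HB.instance Definition _ := GRing.Zmodule_isNzRing.Build corner
  mulA mul1x mulx1 mulDl mulDr one_neq0.

Let scaleAl (c : k) (x y : corner) : c *: (x * y) = (c *: x) * y.
Proof. by apply: val_inj; rewrite /= scalerAl. Qed.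
HB.instance Definition _ := GRing.Lmodule_isLalgebra.Build k corner scaleAl.
Let scaleAr (c : k) (x y : corner) : c *: (x * y) = x * (c *: y).
Proof. by apply: val_inj; rewrite /= scalerAr. Qed.
HB.instance Definition _ := GRing.Lalgebra_isAlgebra.Build k corner scaleAr.

End Corner.

(* A quiver has at least one vertex, so that its path algebra is nontrivial. *)
Record quiver := Quiver {
  vertex : finType;
  arrow : finType;
  src : arrow -> vertex;
  tgt : arrow -> vertex;
  vertex_gt0 : (0 < #|vertex|)%N }.

Section Paths.
Variable Q : quiver.

Fixpoint walk (v : vertex Q) (s : seq (arrow Q)) : bool :=
  if s is a :: s' then (src a == v) && walk (tgt a) s' else true.

(* A path is its starting vertex together with the sequence of its arrows
   in the order in which they are traversed, i.e. from right to left in the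
   product notation. *)
Record qpath := QPath {
  path_val : vertex Q * seq (arrow Q);
  path_walk : walk path_val.1 path_val.2 }.
HB.instance Definition _ := [isSub for path_val].

(* Opaque: unification over [{malg k[qpath]}] becomes intractable if the
   equality test and the choice operator are allowed to unfold. *)
Fact qpath_hasDecEq : hasDecEq qpath.
Proof. exact: (hasDecEq.Build qpath (@val_eqP _ _ qpath)). Qed.
HB.instance Definition _ := qpath_hasDecEq.
Fact qpath_hasChoice : hasChoice qpath.
Proof. exact: (PCanHasChoice (@valK _ _ qpath)). Qed.
HB.instance Definition _ := qpath_hasChoice.

Implicit Types p q r : qpath.

Definition psrc p : vertex Q := (val p).1.
Definition parrows p : seq (arrow Q) := (val p).2.
Definition plen p : nat := size (parrows p).
Definition ptgt p : vertex Q := last (psrc p) [seq tgt a | a <- parrows p].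

Definition ptriv (v : vertex Q) : qpath := Sub (v, [::]) isT.

Let arrow_walk (a : arrow Q) : walk (src a) [:: a].
Proof. by rewrite /= eqxx. Qed.
Definition parrow (a : arrow Q) : qpath := Sub (src a, [:: a]) (arrow_walk a).

(* [path_comp p q] first traverses [q], then [p]. *)
Definition path_comp p q : option qpath :=
  if ptgt q == psrc p then insub (psrc q, parrows q ++ parrows p) else None.

Lemma walk_cat v s1 s2 :
  walk v (s1 ++ s2) = walk v s1 && walk (last v [seq tgt a | a <- s1]) s2.
Proof. by elim: s1 v => //= a s1 IH v; rewrite IH andbA. Qed.

Lemma path_comp_Some p q r : path_comp p q = Some r ->
  [/\ ptgt q = psrc p, psrc r = psrc q, ptgt r = ptgt p &
      parrows r = parrows q ++ parrows p].
Proof.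
rewrite /path_comp; case: eqP => // qp; case: insubP => // u _ def_u [<-].
rewrite /ptgt /psrc /parrows def_u /=; split=> //.
by rewrite map_cat last_cat -[last (val q).1 _]/(ptgt q) qp.
Qed.

Lemma path_comp_defined p q : ptgt q = psrc p ->
  exists2 r, path_comp p q = Some r & val r = (psrc q, parrows q ++ parrows p).
Proof.
move=> qp; rewrite /path_comp qp eqxx.
case: insubP => [u _ def_u|]; first by exists u.
rewrite /= walk_cat -[last _ _]/(ptgt q) qp.
by rewrite (valP q : walk (psrc q) (parrows q)) (valP p).
Qed.

Lemma path_comp_None p q : ptgt q != psrc p -> path_comp p q = None.
Proof. by rewrite /path_comp => /negPf->. Qed.

Lemma path_compA p q r :
  obind (path_comp p) (path_comp q r) = obind (path_comp^~ r) (path_comp p q).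
Proof.
have [rq|rq] := eqVneq (ptgt r) (psrc q); last first.
  rewrite (path_comp_None rq) /=; case pq: (path_comp p q) => [u|] //=.
  by have [_ su _ _] := path_comp_Some pq; rewrite path_comp_None // su.
have [u qr vu] := path_comp_defined rq; have [_ su tu au] := path_comp_Some qr.
rewrite qr /=; have [qp|qp] := eqVneq (ptgt q) (psrc p); last first.
  by rewrite (path_comp_None qp) /= path_comp_None // tu.
have [w pq vw] := path_comp_defined qp; have [_ sw tw aw] := path_comp_Some pq.
rewrite pq /=.
have [|x -> vx] := @path_comp_defined p u; first by rewrite tu.
have [|y -> vy] := @path_comp_defined w r; first by rewrite sw.
by congr Some; apply: val_inj; rewrite vx vy su au aw catA.
Qed.

Lemma path_comp_trivl v p :
  path_comp (ptriv v) p = if ptgt p == v then Some p else None.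
Proof.
have [pv|pv] := eqVneq (ptgt p) v; last by rewrite path_comp_None.
have [|u -> vu] := @path_comp_defined (ptriv v) p; first by [].
by congr Some; apply: val_inj; rewrite vu cats0 [RHS]surjective_pairing.
Qed.

Lemma path_comp_trivr v p :
  path_comp p (ptriv v) = if v == psrc p then Some p else None.
Proof.
have [pv|pv] := eqVneq v (psrc p); last by rewrite path_comp_None.
have [|u -> vu] := @path_comp_defined p (ptriv v); first by [].
congr Some; apply: val_inj; rewrite vu [RHS]surjective_pairing.
by rewrite -/(psrc p) -/(parrows p) -pv.
Qed.

End Paths.

Section LinearExtension.
Variables (k : fieldType) (K : choiceType) (V : lmodType k).

Definition lin_ext (f : K -> V) (x : {malg k[K]}) : V :=
  \sum_(p <- msupp x) x@_p *: f p.

Lemma lin_extEw f (d : {fset K}) x :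
  (msupp x `<=` d)%fset -> lin_ext f x = \sum_(p <- d) x@_p *: f p.
Proof.
move=> le_xd; apply/big_fset_incl => //= p _ /mcoeff_outdom->.
by rewrite scale0r.
Qed.

Lemma lin_extP f : linear (lin_ext f).
Proof.
move=> c x y; pose d := (msupp x `|` msupp y)%fset.
rewrite !(@lin_extEw _ d) ?fsubsetUl ?fsubsetUr //.
  rewrite scaler_sumr -big_split; apply: eq_bigr => p _ /=.
  by rewrite mcoeffD mcoeffZ scalerDl scalerA.
apply: (fsubset_trans (msuppD_le _ _)); apply: fsetSU; exact: msuppZ_le.
Qed.

Lemma lin_extU f p : lin_ext f << p >> = f p.
Proof.
rewrite (@lin_extEw _ [fset p]%fset) ?msuppU_le // big_seq_fset1.
by rewrite mcoeffUU scale1r.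
Qed.

Lemma malg_decomp (x : {malg k[K]}) :
  x = \sum_(p <- msupp x) x@_p *: (<< p >> : {malg k[K]}).
Proof.
rewrite [LHS]monalgE; apply: eq_bigr => p _.
by apply/malgP => q; rewrite mcoeffZ !mcoeffU mulrnAr mulr1.
Qed.

Lemma malg_linear_eq (f g : {malg k[K]} -> V) :
  linear f -> linear g -> (forall p, f << p >> = g << p >>) -> f =1 g.
Proof.
move=> lf lg fg x.
have sum0 (h : {malg k[K]} -> V) (lh : linear h) r :
    h (\sum_(p <- r) x@_p *: (<< p >> : {malg k[K]})) =
    \sum_(p <- r) x@_p *: h << p >>.
  elim: r => [|p r IH]; last by rewrite !big_cons lh IH.
  rewrite !big_nil; have := lh 1 0 0.
  rewrite !scale1r addr0 => /eqP.
  by rewrite -[X in X == _]addr0 (inj_eq (addrI _)) eq_sym => /eqP.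
rewrite (malg_decomp x) !sum0 //; apply: eq_bigr => p _; by rewrite fg.
Qed.

End LinearExtension.

Definition path_alg (k : fieldType) (Q : quiver) : Type := {malg k[qpath Q]}.

HB.instance Definition _ (k : fieldType) (Q : quiver) :=
  GRing.Lmodule.on (path_alg k Q).

HB.lock Definition pbasis (k : fieldType) (Q : quiver) (p : qpath Q) :
  path_alg k Q := << p >>.

Definition pbasis_mul (k : fieldType) (Q : quiver) (p q : qpath Q) :
    path_alg k Q :=
  if path_comp p q is Some r then pbasis k r else 0.

Definition path_one (k : fieldType) (Q : quiver) : path_alg k Q :=
  \sum_(v : vertex Q) pbasis k (ptriv v).

HB.lock Definition path_mul (k : fieldType) (Q : quiver) (x y : path_alg k Q) :
    path_alg k Q :=
  \sum_(p <- msupp x) \sum_(q <- msupp y)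
    (x@_p * y@_q) *: pbasis_mul k p q.

Section PathAlgebra.
Variables (k : fieldType) (Q : quiver).

Local Notation path_alg := (path_alg k Q).
Local Notation pbasis := (@pbasis k Q).
Local Notation pbasis_mul := (@pbasis_mul k Q).
Local Notation path_one := (@path_one k Q).
Local Notation path_mul := (@path_mul k Q).

Implicit Types x y z : path_alg.

Lemma pbasisE p : pbasis p = << p >>.
Proof. by rewrite pbasis.unlock. Qed.

Let linear_eq (V : lmodType k) (f g : path_alg -> V) :
  linear f -> linear g -> (forall p, f (pbasis p) = g (pbasis p)) -> f =1 g.
Proof.
by move=> lf lg fg; apply: malg_linear_eq => // p; rewrite -pbasisE.
Qed.

Let mulE x y :
  path_mul x y = lin_ext (fun p => lin_ext (pbasis_mul p) y) x.
Proof.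
rewrite path_mul.unlock.
apply: eq_bigr => p _; rewrite scaler_sumr; apply: eq_bigr => q _.
by rewrite scalerA.
Qed.

Let linl y : linear (path_mul^~ y).
Proof. by move=> c x z; rewrite !mulE lin_extP. Qed.

Let linr x : linear (path_mul x).
Proof.
move=> c y z; rewrite !mulE /lin_ext scaler_sumr -big_split.
apply: eq_bigr => p _ /=; rewrite -/(lin_ext _ _) lin_extP.
by rewrite scalerDr scalerA mulrC -scalerA.
Qed.

Let mulUU p q : path_mul (pbasis p) (pbasis q) = pbasis_mul p q.
Proof. by rewrite mulE !pbasisE !lin_extU. Qed.

Let lin0 (f : path_alg -> path_alg) : linear f -> f 0 = 0.
Proof.
move=> lf; have := lf 1 0 0; rewrite !scale1r addr0 => /eqP.
by rewrite -[X in X == _]addr0 (inj_eq (addrI _)) eq_sym => /eqP.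
Qed.

Let linZ (f : path_alg -> path_alg) c x :
  linear f -> f (c *: x) = c *: f x.
Proof. by move=> lf; have := lf c x 0; rewrite (lin0 lf) !addr0. Qed.

Let lin_comp (f g : path_alg -> path_alg) :
  linear f -> linear g -> linear (f \o g).
Proof. by move=> lf lg c x y; rewrite /= lg lf. Qed.

Let lin_id : linear (@id path_alg). Proof. by []. Qed.

Let mulA : associative path_mul.
Proof.
move=> x y z; move: x.
apply: linear_eq; [exact: linl | exact: (lin_comp (linl z) (linl y))|].
move=> p; move: y.
apply: linear_eq.
- exact: (lin_comp (linr _) (linl z)).
- exact: (lin_comp (linl z) (linr _)).
move=> q; move: z.
apply: linear_eq; [exact: (lin_comp (linr _) (linr _))| exact: linr |].
move=> r.
rewrite (mulUU q r) (mulUU p q) /pbasis_mul.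
have := path_compA p q r.
case: (path_comp q r) => [u|] /=; case: (path_comp p q) => [w|] /= h;
  rewrite ?mulUU ?(lin0 (linr _)) ?(lin0 (linl _)) /pbasis_mul //.
- by rewrite h.
- by rewrite h.
- by rewrite -h.
Qed.

Let lin_sum (f : path_alg -> path_alg) (T : finType) (F : T -> path_alg) :
  linear f -> f (\sum_i F i) = \sum_i f (F i).
Proof.
move=> lf; apply: (big_morph f _ (lin0 lf)) => x y.
by have := lf 1 x y; rewrite !scale1r.
Qed.

Let mul1x : left_id path_one path_mul.
Proof.
apply: linear_eq; [exact: linr | exact: lin_id | move=> p].
rewrite (lin_sum _ (linl _)) (bigD1 (ptgt p)) //=.
rewrite mulUU /pbasis_mul path_comp_trivl eqxx big1 ?addr0 // => v /negPf.
by rewrite mulUU /pbasis_mul path_comp_trivl eq_sym => ->.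
Qed.

Let mulx1 : right_id path_one path_mul.
Proof.
apply: linear_eq; [exact: linl | exact: lin_id | move=> p].
rewrite (lin_sum _ (linr _)) (bigD1 (psrc p)) //=.
rewrite mulUU /pbasis_mul path_comp_trivr eqxx big1 ?addr0 // => v /negPf.
by rewrite mulUU /pbasis_mul path_comp_trivr => ->.
Qed.

Let mulDl : left_distributive path_mul +%R.
Proof. by move=> x y z; have := linl z 1 x y; rewrite !scale1r. Qed.
Let mulDr : right_distributive path_mul +%R.
Proof. by move=> x y z; have := linr x 1 y z; rewrite !scale1r. Qed.

Let mcoeff1_triv v : path_one@_(ptriv v) = 1.
Proof.
rewrite /path_one raddf_sum /= (bigD1 v) //= pbasisE mcoeffUU big1 ?addr0 // => w wv.
rewrite pbasisE mcoeffU; suff /negPf-> : ptriv w != ptriv v by [].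
by apply: contra wv => /eqP/(congr1 (@psrc Q)) h; apply/eqP.
Qed.

Let one_neq0 : path_one != 0.
Proof.
apply/eqP => one0; have /card_gt0P[v _] := vertex_gt0 Q.
by have /eqP := mcoeff1_triv v; rewrite one0 mcoeff0 eq_sym oner_eq0.
Qed.

HB.instance Definition _ := GRing.Zmodule_isNzRing.Build path_alg
  mulA mul1x mulx1 mulDl mulDr one_neq0.

Let scaleAl (c : k) x y : c *: (x * y) = (c *: x) * y.
Proof. by symmetry; exact: (linZ c x (linl y)). Qed.
HB.instance Definition _ := GRing.Lmodule_isLalgebra.Build k path_alg scaleAl.
Let scaleAr (c : k) x y : c *: (x * y) = x * (c *: y).
Proof. by symmetry; exact: (linZ c y (linr x)). Qed.
HB.instance Definition _ := GRing.Lalgebra_isAlgebra.Build k path_alg scaleAr.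

Lemma pbasisM p q : pbasis p * pbasis q = pbasis_mul p q.
Proof. exact: mulUU. Qed.

Definition arr (a : arrow Q) : path_alg := pbasis (parrow a).

Lemma path_one_coeff v : (1 : path_alg)@_(ptriv v) = 1.
Proof. exact: mcoeff1_triv. Qed.

Lemma coeff_trivM v x y :
  (x * y)@_(ptriv v) = x@_(ptriv v) * y@_(ptriv v).
Proof.
pose kk := GRing.regular k.
suff h : (fun x : path_alg => (x * y)@_(ptriv v) : kk)
    =1 (fun x => x@_(ptriv v) * y@_(ptriv v) : kk) by exact: h.
apply: linear_eq => [c a b|c a b|p].
- by rewrite mulrDl -scalerAl mcoeffD mcoeffZ.
- by rewrite mcoeffD mcoeffZ mulrDl -mulrA.
suff h : (fun y : path_alg => (pbasis p * y)@_(ptriv v) : kk)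
    =1 (fun y => (pbasis p)@_(ptriv v) * y@_(ptriv v) : kk) by exact: h.
apply: linear_eq => [c a b|c a b|q].
- by rewrite mulrDr -scalerAr mcoeffD mcoeffZ.
- by rewrite mcoeffD mcoeffZ mulrDr mulrCA.
rewrite pbasisM /pbasis_mul !pbasisE !mcoeffU.
case pq: (path_comp p q) => [r|].
  have [tq sr tr ar] := path_comp_Some pq.
  rewrite pbasisE mcoeffU -natrM mulnb; congr (_ *+ nat_of_bool _).
  apply/eqP/andP => [rv|[/eqP pv /eqP qv]].
    move: ar; rewrite rv /= => /esym/nilP; rewrite /nilp size_cat addn_eq0.
    move=> /andP[/nilP q0 /nilP p0].
    move: sr tr; rewrite rv /= => qv pv.
    split; apply/eqP; apply: val_inj.
      rewrite [LHS]surjective_pairing -/(psrc p) -/(parrows p) p0 /=.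
      by move: pv; rewrite /ptgt p0 /= => <-.
    by rewrite [LHS]surjective_pairing -/(psrc q) -/(parrows q) q0 /= -qv.
  apply: val_inj; rewrite [LHS]surjective_pairing -/(psrc r) -/(parrows r).
  by rewrite sr ar pv qv.
rewrite mcoeff0; case: eqP pq => [->|_ _]; last by rewrite mul0r.
by case: eqP => [->|_ _]; [rewrite path_comp_trivl eqxx | rewrite mulr0].
Qed.

End PathAlgebra.

Lemma gen_ideal_proper (k : fieldType) (Q : quiver)
    (S : path_alg k Q -> Prop) (v : vertex Q) :
  (forall s, S s -> s@_(ptriv v) = 0) -> ~ gen_ideal S 1.
Proof.
move=> S0 gen1; suff /eqP : (1 : path_alg k Q)@_(ptriv v) = 0.
  by rewrite path_one_coeff oner_eq0.
apply: (gen1 (fun x => x@_(ptriv v) = 0)) => //.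
split=> [|x y x0 y0|a x x0|a x x0]; rewrite ?mcoeff0 //.
- by rewrite mcoeffD x0 y0 addr0.
- by rewrite coeff_trivM x0 mulr0.
- by rewrite coeff_trivM x0 mul0r.
Qed.

Section StringAlgebra.
Variables (k : fieldType) (Q : quiver).

(* The [n]-th power of the two-sided ideal generated by the arrows: it is
   generated by the products of [n] arrows, i.e. by the paths of length [n]. *)
Definition arrow_ideal_pow (n : nat) : path_alg k Q -> Prop :=
  gen_ideal (fun x => exists2 p : qpath Q, plen p = n & x = pbasis k p).

Definition admissible (I : path_alg k Q -> Prop) : Prop :=
  (forall x, I x -> arrow_ideal_pow 2 x) /\
  exists2 m, (2 <= m)%N & forall x, arrow_ideal_pow m x -> I x.

Definition generated_by_paths (I : path_alg k Q -> Prop) : Prop :=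
  exists P : qpath Q -> Prop,
    forall x, I x <-> gen_ideal (fun y => exists2 p, P p & y = pbasis k p) x.

Definition string_ideal (I : path_alg k Q -> Prop) : Prop :=
  [/\ admissible I,
      generated_by_paths I,
      forall v : vertex Q,
        (#|[set a : arrow Q | src a == v]| <= 2)%N /\
        (#|[set a : arrow Q | tgt a == v]| <= 2)%N,
      forall d e1 e2 : arrow Q,
        src e1 = tgt d -> ~ I (arr k e1 * arr k d) ->
        src e2 = tgt d -> ~ I (arr k e2 * arr k d) -> e1 = e2 &
      forall d e1 e2 : arrow Q,
        src d = tgt e1 -> ~ I (arr k d * arr k e1) ->
        src d = tgt e2 -> ~ I (arr k d * arr k e2) -> e1 = e2].

End StringAlgebra.

Definition string_algebra (k : fieldType) (B : algType k) : Prop :=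
  exists (Q : quiver) (I : proper_ideal (path_alg k Q)),
    string_ideal I /\ alg_iso B (quot_alg I).

Definition mod_iso (A : pzRingType) (V W : lmodType A) : Prop :=
  exists f : {linear V -> W}, bijective f.

Definition indecomposable (A : pzRingType) (V : lmodType A) : Prop :=
  (exists v : V, v != 0) /\
  forall U W : lmodType A, mod_iso V (U * W)%type ->
    (forall u : U, u = 0) \/ (forall w : W, w = 0).

(* An [A]-module is a [k]-vector space through [c |-> c%:A]. *)
Definition fin_dim (k : fieldType) (A : algType k) (V : lmodType A) : Prop :=
  exists (n : nat) (b : 'I_n -> V), forall x : V,
    exists c : 'I_n -> k, x = \sum_i ((c i)%:A : A) *: b i.

Definition infinite_rep_type (k : fieldType) (A : algType k) : Prop :=
  exists M : nat -> lmodType A,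
    (forall i, fin_dim (M i) /\ indecomposable (M i)) /\
    (forall i j, mod_iso (M i) (M j) -> i = j).

(* Morita equivalence of $k$-algebras: a $k$-linear equivalence between the
   categories of all left modules. *)
Record mod_functor (k : fieldType) (A B : algType k) := ModFunctor {
  fobj :> lmodType A -> lmodType B;
  fmap : forall U V : lmodType A, {linear U -> V} -> {linear fobj U -> fobj V};
  fmap_id : forall (U : lmodType A) (f : {linear U -> U}),
    f =1 id -> fmap f =1 id;
  fmap_comp : forall (U V W : lmodType A) (f : {linear U -> V})
      (g : {linear V -> W}) (h : {linear U -> W}),
    h =1 g \o f -> fmap h =1 fmap g \o fmap f;
  fmap_add : forall (U V : lmodType A) (f g h : {linear U -> V}),
    (forall x, h x = f x + g x) -> forall y, fmap h y = fmap f y + fmap g y;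
  fmap_scale : forall (U V : lmodType A) (c : k) (f h : {linear U -> V}),
    (forall x, h x = (c%:A : A) *: f x) ->
    forall y, fmap h y = (c%:A : B) *: fmap f y }.

Definition morita_equivalent (k : fieldType) (A B : algType k) : Prop :=
  exists (F : mod_functor A B) (G : mod_functor B A)
         (eta : forall V : lmodType A, {linear V -> G (F V)})
         (theta : forall W : lmodType B, {linear W -> F (G W)}),
    [/\ forall V, bijective (eta V),
        forall (U V : lmodType A) (f : {linear U -> V}),
          eta V \o f =1 fmap G (fmap F f) \o eta U,
        forall W, bijective (theta W) &
        forall (U W : lmodType B) (f : {linear U -> W}),
          theta W \o f =1 fmap F (fmap G f) \o theta U].

Inductive Qvertex := v1 | v2 | v3 | v4.
Inductive Qarrow := alpha | beta | gamma.

Definition Qvertex_ord (v : Qvertex) : 'I_4 :=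
  match v with
  | v1 => @Ordinal 4 0 isT | v2 => @Ordinal 4 1 isT
  | v3 => @Ordinal 4 2 isT | v4 => @Ordinal 4 3 isT
  end.
Definition ord_Qvertex (i : 'I_4) : Qvertex := nth v1 [:: v1; v2; v3; v4] i.
Lemma Qvertex_ordK : cancel Qvertex_ord ord_Qvertex.
Proof. by case. Qed.
HB.instance Definition _ := Finite.copy Qvertex (can_type Qvertex_ordK).

Definition Qarrow_ord (a : Qarrow) : 'I_3 :=
  match a with
  | alpha => @Ordinal 3 0 isT | beta => @Ordinal 3 1 isT
  | gamma => @Ordinal 3 2 isT
  end.
Definition ord_Qarrow (i : 'I_3) : Qarrow := nth alpha [:: alpha; beta; gamma] i.
Lemma Qarrow_ordK : cancel Qarrow_ord ord_Qarrow.
Proof. by case. Qed.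
HB.instance Definition _ := Finite.copy Qarrow (can_type Qarrow_ordK).

Definition Qsrc (a : Qarrow) : Qvertex :=
  match a with alpha => v1 | beta => v2 | gamma => v1 end.
Definition Qtgt (a : Qarrow) : Qvertex :=
  match a with alpha => v2 | beta => v1 | gamma => v1 end.

Lemma Qvertex_gt0 : (0 < #|{: Qvertex}|)%N.
Proof. by apply/card_gt0P; exists v1. Qed.

Definition Q22 : quiver := @Quiver Qvertex Qarrow Qsrc Qtgt Qvertex_gt0.

Section Relations.
Variable k : fieldType.
Local Notation a := (arr k (alpha : arrow Q22)).
Local Notation b := (arr k (beta : arrow Q22)).
Local Notation c := (arr k (gamma : arrow Q22)).

Definition relations (x : path_alg k Q22) : Prop :=
  [\/ x = a * b, x = c * b, x = c ^+ 2 | x = a * c].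

Let relations_proper : ~ gen_ideal relations 1.
Proof.
have arr0 d : (arr k (d : arrow Q22))@_(ptriv (v1 : vertex Q22)) = 0.
  by rewrite /arr pbasisE mcoeffU; case: eqP.
apply: (@gen_ideal_proper _ _ _ (v1 : vertex Q22)) => s.
by case=> ->; rewrite ?expr2 coeff_trivM arr0 mul0r.
Qed.

Definition I22 : proper_ideal (path_alg k Q22) :=
  ProperIdeal (gen_two_sided relations) relations_proper.

End Relations.

(* Main.v *)
From HB Require Import structures.
Require Import Defs.
From mathcomp Require Import all_boot all_algebra.
From mathcomp Require Import finmap boolp.
From mathcomp Require Import monalg.
From mathcomp Require Import ring zify.

(** Let [T n] be the algebra of tuples [(a, g, z, w, v, M, N, t)] with [a], [g],
    [z], [t] scalars, [w] a row, [v] a column and [M], [N] matrices of size [n],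
    where [t] and [N] multiply separately and the rest multiplies as the pair of
    block matrices [[a, w, z], [0, M, v], [0, 0, a]] and [[a, g], [0, a]].

    In characteristic 2, sending a matrix [m] over the field with two elements
    to [(d, s, r, R, C, m, d m, 1)] identifies $kM(2,2)$ with [T 2]: here [d] is
    the determinant, [s] the sign of [m] in $GL_2(\mathbb F_2) \cong S_3$
    (additively, and 0 if [m] is singular), [r] is 1 if [m] has rank one and 0
    otherwise, and [m = C R] if [m] has rank one, [C] and [R] being 0 otherwise.
    Modulo the nilpotent coordinates [g], [z], [w], [v], the algebra [T 2] is a
    product of matrix algebras, which gives its primitive idempotents up to
    conjugacy and identifies its basic algebra with [T 1].  The latter is
    $kQ/I$, with [w], [v], [g], [z] the coordinates along $\beta$, $\alpha$,
    $\gamma$, $\beta\alpha$.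

    Finally $\gamma$ and $\beta\alpha$ act as two independent square-zero maps,
    so that Kronecker modules provide infinitely many indecomposables. *)

Set Implicit Arguments.
Unset Strict Implicit.
Unset Printing Implicit Defensive.

Import GRing.Theory.

Local Open Scope ring_scope.

(** * The block algebras *)

Section BlockAlgebra.
Variables (k : fieldType) (n : nat).

(** [k^o] is [k] as a module over itself: the product type then supplies the vector space structure,
    and only the multiplication has to be built. *)
Definition block_alg : Type :=
  k^o * k^o * k^o * 'rV[k]_n * 'cV[k]_n * 'M[k]_n * 'M[k]_n * k^o.

HB.instance Definition _ := GRing.Lmodule.on block_alg.

Definition dot (w : 'rV[k]_n) (v : 'cV[k]_n) : k := (w *m v) 0 0.

Lemma dotDl w w' v : dot (w + w') v = dot w v + dot w' v.
Proof. by rewrite /dot mulmxDl mxE. Qed.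
Lemma dotDr w v v' : dot w (v + v') = dot w v + dot w v'.
Proof. by rewrite /dot mulmxDr mxE. Qed.
Lemma dotZl c w v : dot (c *: w) v = c * dot w v.
Proof. by rewrite /dot -scalemxAl mxE. Qed.
Lemma dotZr c w v : dot w (c *: v) = c * dot w v.
Proof. by rewrite /dot -scalemxAr mxE. Qed.
Lemma dot0l v : dot 0 v = 0.
Proof. by rewrite /dot mul0mx mxE. Qed.
Lemma dot0r w : dot w 0 = 0.
Proof. by rewrite /dot mulmx0 mxE. Qed.
Lemma dotA w (M : 'M_n) v : dot (w *m M) v = dot w (M *m v).
Proof. by rewrite /dot mulmxA. Qed.

Implicit Types x y : block_alg.

Definition blk (a g z : k) (w : 'rV_n) (v : 'cV_n) (M N : 'M_n) (t : k) :
  block_alg := (a, g, z, w, v, M, N, t).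

Lemma blk_ind (P : block_alg -> Prop) :
  (forall a g z w v M N t, P (blk a g z w v M N t)) -> forall x, P x.
Proof.
by move=> Pblk [[[[[[[a g] z] w] v] M] N] t]; apply: (Pblk a g z w v M N t).
Qed.

Lemma blk_eq (a a' : k) (g g' : k) (z z' : k) (w w' : 'rV_n) (v v' : 'cV_n)
    (M M' N N' : 'M_n) (t t' : k) :
  a = a' -> g = g' -> z = z' -> w = w' -> v = v' -> M = M' -> N = N' ->
  t = t' -> blk a g z w v M N t = blk a' g' z' w' v' M' N' t'.
Proof. by do 8![move=> ->]. Qed.

Lemma blkD (a a' : k) (g g' : k) (z z' : k) (w w' : 'rV_n) (v v' : 'cV_n)
    (M M' N N' : 'M_n) (t t' : k) :
  blk a g z w v M N t + blk a' g' z' w' v' M' N' t' =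
  blk (a + a') (g + g') (z + z') (w + w') (v + v') (M + M') (N + N') (t + t').
Proof. by []. Qed.

Lemma blkZ (c a : k) (g : k) (z : k) (w : 'rV_n) (v : 'cV_n)
    (M N : 'M_n) (t : k) :
  c *: blk a g z w v M N t =
  blk (c * a) (c * g) (c * z) (c *: w) (c *: v) (c *: M) (c *: N) (c * t).
Proof. by []. Qed.

Definition block_one : block_alg := blk 1 0 0 0 0 1%:M 1%:M 1.
Definition block_mul x y : block_alg :=
  let: (a, g, z, w, v, M, N, t) := x in
  let: (a', g', z', w', v', M', N', t') := y in
  blk (a * a') (a * g' + g * a') (a * z' + z * a' + dot w v')
    (a *: w' + w *m M') (a' *: v + M *m v') (M *m M') (N *m N') (t * t').

Let block_mulE (a a' : k) (g g' : k) (z z' : k) (w w' : 'rV_n)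
    (v v' : 'cV_n) (M M' N N' : 'M_n) (t t' : k) :
  block_mul (blk a g z w v M N t) (blk a' g' z' w' v' M' N' t') =
  blk (a * a') (a * g' + g * a') (a * z' + z * a' + dot w v')
    (a *: w' + w *m M') (a' *: v + M *m v') (M *m M') (N *m N') (t * t').
Proof. by []. Qed.

Let mulA : associative block_mul.
Proof.
elim/blk_ind=> a g z w v M N t; elim/blk_ind=> a1 g1 z1 w1 v1 M1 N1 t1.
elim/blk_ind=> a2 g2 z2 w2 v2 M2 N2 t2.
rewrite !block_mulE; apply: blk_eq.
- by rewrite mulrA.
- by ring.
(* In the corner entry [z] the only product that is not scalar is [w M v], and [dotA] makes its two
   bracketings agree. *)
- by rewrite !(dotDl, dotDr, dotZl, dotZr, dotA); ring.
- by rewrite mulmxDl !scalerDr !scalerA !mulmxA -!scalemxAl addrA.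
- by rewrite mulmxDr !scalerDr !scalerA !mulmxA -!scalemxAr addrA (mulrC a1).
- by rewrite mulmxA.
- by rewrite mulmxA.
- by rewrite mulrA.
Qed.

Let mul1x : left_id block_one block_mul.
Proof.
elim/blk_ind=> a g z w v M N t; rewrite block_mulE.
by rewrite !mul1r !mul0r !mul0mx !mul1mx dot0l scale1r scaler0 !addr0 add0r.
Qed.

Let mulx1 : right_id block_one block_mul.
Proof.
elim/blk_ind=> a g z w v M N t; rewrite block_mulE.
by rewrite !mulr1 !mulr0 !mulmx0 !mulmx1 dot0r scale1r scaler0 !addr0 !add0r.
Qed.

Let mulDl : left_distributive block_mul +%R.
Proof.
elim/blk_ind=> a g z w v M N t; elim/blk_ind=> a1 g1 z1 w1 v1 M1 N1 t1.
elim/blk_ind=> a2 g2 z2 w2 v2 M2 N2 t2.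
rewrite blkD !block_mulE blkD.
apply: blk_eq; rewrite ?dotDl; [ring|ring|ring|..|ring].
- by rewrite mulmxDl scalerDl addrACA.
- by rewrite mulmxDl scalerDr addrACA.
- by rewrite mulmxDl.
- by rewrite mulmxDl.
Qed.

Let mulDr : right_distributive block_mul +%R.
Proof.
elim/blk_ind=> a g z w v M N t; elim/blk_ind=> a1 g1 z1 w1 v1 M1 N1 t1.
elim/blk_ind=> a2 g2 z2 w2 v2 M2 N2 t2.
rewrite blkD !block_mulE blkD.
apply: blk_eq; rewrite ?dotDr; [ring|ring|ring|..|ring].
- by rewrite mulmxDr scalerDr addrACA.
- by rewrite mulmxDr scalerDl addrACA.
- by rewrite mulmxDr.
- by rewrite mulmxDr.
Qed.

Let one_neq0 : block_one != 0.
Proof. by apply/eqP => /(congr1 (fun x => x.2))/eqP; rewrite oner_eq0. Qed.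

HB.instance Definition _ := GRing.Zmodule_isNzRing.Build block_alg
  mulA mul1x mulx1 mulDl mulDr one_neq0.

Lemma blkM (a a' : k) (g g' : k) (z z' : k) (w w' : 'rV_n) (v v' : 'cV_n)
    (M M' N N' : 'M_n) (t t' : k) :
  blk a g z w v M N t * blk a' g' z' w' v' M' N' t' =
  blk (a * a') (a * g' + g * a') (a * z' + z * a' + dot w v')
    (a *: w' + w *m M') (a' *: v + M *m v') (M *m M') (N *m N') (t * t').
Proof. by []. Qed.

Let scaleAl (c : k) x y : c *: (x * y) = (c *: x) * y.
Proof.
elim/blk_ind: x => a g z w v M N t.
elim/blk_ind: y => a1 g1 z1 w1 v1 M1 N1 t1.
rewrite blkZ !blkM blkZ.
apply: blk_eq; rewrite ?dotZl; [ring|ring|ring|..|ring].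
- by rewrite scalerDr scalerA scalemxAl.
- by rewrite scalerDr !scalerA scalemxAl mulrC.
- by rewrite scalemxAl.
- by rewrite scalemxAl.
Qed.
HB.instance Definition _ :=
  GRing.Lmodule_isLalgebra.Build k block_alg scaleAl.

Let scaleAr (c : k) x y : c *: (x * y) = x * (c *: y).
Proof.
elim/blk_ind: x => a g z w v M N t.
elim/blk_ind: y => a1 g1 z1 w1 v1 M1 N1 t1.
rewrite blkZ !blkM blkZ.
apply: blk_eq; rewrite ?dotZr; [ring|ring|ring|..|ring].
- by rewrite scalerDr !scalerA scalemxAr mulrC.
- by rewrite scalerDr !scalerA scalemxAr.
- by rewrite scalemxAr.
- by rewrite scalemxAr.
Qed.
HB.instance Definition _ :=
  GRing.Lalgebra_isAlgebra.Build k block_alg scaleAr.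

End BlockAlgebra.

(** * Idempotents and corner algebras *)

Section AlgebraIsomorphisms.
Variable k : fieldType.
Implicit Types A B C : algType k.

Lemma alg_isoI A B (f : A -> B) :
  linear f -> monoid_morphism f -> bijective f -> alg_iso A B.
Proof.
move=> lf mf bf.
pose F : {lrmorphism A -> B} := HB.pack f
  (GRing.isLinear.Build k A B _ f lf) (GRing.isMonoidMorphism.Build A B f mf).
by exists F.
Qed.

Lemma lrmorphism_inv A B (f : {lrmorphism A -> B}) : bijective f ->
  exists2 g : {lrmorphism B -> A}, cancel f g & cancel g f.
Proof.
case=> g fK gK.
have lg : linear g.
  by move=> c x y; apply: (can_inj fK); rewrite gK linearP /= !gK.
have mg : monoid_morphism g.
  split=> [|x y]; apply: (can_inj fK); rewrite gK ?rmorph1 //.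
  by rewrite rmorphM /= !gK.
pose G : {lrmorphism B -> A} := HB.pack g
  (GRing.isLinear.Build k B A _ g lg) (GRing.isMonoidMorphism.Build B A g mg).
by exists G.
Qed.

Lemma alg_iso_trans B A C : alg_iso A B -> alg_iso B C -> alg_iso A C.
Proof.
by case=> f bf [g bg]; exists (g \o f : {lrmorphism A -> C}); apply: bij_comp.
Qed.

End AlgebraIsomorphisms.

Section PrimitiveIdempotents.
Variable A : nzRingType.
Implicit Types a b e f u v x y : A.

(** A summand [a] of an orthogonal decomposition of [e] satisfies [e a = a = a e], so it suffices to
    look at the idempotents of [e A e]. *)
Lemma primitive_idemI e : e != 0 -> e * e = e ->
  (forall x, x * x = x -> e * x = x -> x * e = x -> x = 0 \/ x = e) ->
  primitive_idem e.
Proof.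
move=> e0 ee esub; split=> // a b aa bb ab ba def_e.
have [| |->|ae] := esub a aa; first by rewrite def_e mulrDl aa ba addr0.
- by rewrite def_e mulrDr aa ab addr0.
- by left.
by right; apply: (addrI a); rewrite -def_e addr0.
Qed.

(** Primitivity is applied to the orthogonal decomposition [e = x + (e - x)]. *)
Lemma primitive_idem_sub e x : primitive_idem e ->
  x * x = x -> e * x = x -> x * e = x -> x = 0 \/ x = e.
Proof.
case=> _ ee esub xx ex xe.
have := esub x (e - x) xx; case.
- by rewrite mulrBl !mulrBr ee ex xe xx subrr subr0.
- by rewrite mulrBr xe xx subrr.
- by rewrite mulrBl ex xx subrr.
- by rewrite addrC subrK.
- by left.
by move/eqP; rewrite subr_eq0 => /eqP->; right.
Qed.

Lemma conj_idem_refl e : conj_idem e e.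
Proof. by exists 1, 1; rewrite !mulr1 mul1r. Qed.

Lemma conj_idem_sym e f : conj_idem e f -> conj_idem f e.
Proof.
case=> u [v [uv vu ->]]; exists v, u; split=> //.
by rewrite !mulrA vu mul1r -mulrA vu mulr1.
Qed.

Lemma conj_idem_trans f e g : conj_idem e f -> conj_idem f g -> conj_idem e g.
Proof.
case=> u [v [uv vu ->]] [u' [v' [uv' vu' ->]]].
exists (u' * u), (v * v'); split; last by rewrite !mulrA.
  by rewrite mulrA -(mulrA u') uv mulr1.
by rewrite mulrA -(mulrA v) vu' mulr1.
Qed.

(** Conjugation is a ring automorphism, so it carries the idempotents below [f] to those below
    [e]. *)
Lemma conj_primitive_idem e f :
  conj_idem e f -> primitive_idem e -> primitive_idem f.
Proof.
move=> cef pe; have [e0 ee _] := pe; case: cef => u [v [uv vu def_f]].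
have conjK x : u * (v * x * u) * v = x.
  by rewrite !mulrA uv mul1r -mulrA uv mulr1.
have conjM x y : (v * x * u) * (v * y * u) = v * (x * y) * u.
  by rewrite !mulrA -(mulrA _ u v) uv mulr1.
have def_e : e = v * f * u.
  by rewrite def_f !mulrA vu mul1r -mulrA vu mulr1.
apply: primitive_idemI.
- by apply: contra e0 => /eqP f0; rewrite def_e f0 mulr0 mul0r.
- by rewrite -(conjK (f * f)) -conjM -def_e ee.
move=> x xx fx xf.
case: (@primitive_idem_sub e (v * x * u) pe) => [| | |x0|xe].
- by rewrite conjM xx.
- by rewrite def_e conjM fx.
- by rewrite def_e conjM xf.
- by left; rewrite -(conjK x) x0 mulr0 mul0r.
by right; rewrite -(conjK x) xe.
Qed.

(** Orthogonal representatives of the conjugacy classes, indexed by ['I_t] itself instead of as an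
    initial segment of a decomposition of 1. *)
Definition basic_family t (b : 'I_t -> A) : Prop :=
  [/\ forall i, primitive_idem (b i),
      forall i j, i != j -> b i * b j = 0,
      forall i j, conj_idem (b i) (b j) -> i = j &
      forall f, primitive_idem f -> exists i, conj_idem (b i) f].

Lemma basic_idem_family e : basic_idem e ->
  exists t (b : 'I_t -> A), basic_family b /\ e = \sum_i b i.
Proof.
case=> s [t [eps [[ts _ peps oeps] [ceps feps ->]]]].
exists t, (eps \o widen_ord ts); split; last by rewrite big_ord_narrow.
split=> [i|i j ij|i j cij|f /feps[i it ci]] //=.
- by apply: oeps.
- have := ceps (widen_ord ts i) (widen_ord ts j) (ltn_ord i) (ltn_ord j) cij.
  by move/(congr1 val) => /= /val_inj.
by exists (Ordinal it); rewrite /= (_ : widen_ord _ _ = i) //; apply: val_inj.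
Qed.

(** Both families represent the same classes, so conjugacy matches their indices. If
    [b_i = u_i b'_j v_i] for matched [i] and [j], then the sums of the [v_i b_i] and of the
    [b_i u_i] pass between the two total idempotents. *)
Lemma basic_family_equiv t t' (b : 'I_t -> A) (b' : 'I_t' -> A) :
  basic_family b -> basic_family b' ->
  exists x y, [/\ x * y = \sum_i b' i, y * x = \sum_i b i,
    (\sum_i b' i) * x = x & x * (\sum_i b i) = x] /\
    ((\sum_i b i) * y = y /\ y * (\sum_i b' i) = y).
Proof.
move=> [pb ob cb fb] [pb' ob' cb' fb'].
have bb i : b i * b i = b i by case: (pb i).
have bb' i : b' i * b' i = b' i by case: (pb' i).
(* [s i] packs the index of the member of [b'] conjugate to [b i] with the two conjugating units. *)
have [s sP] : exists s : 'I_t -> 'I_t' * A * A, forall i,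
    [/\ (s i).1.2 * (s i).2 = 1, (s i).2 * (s i).1.2 = 1 &
        b i = (s i).1.2 * b' (s i).1.1 * (s i).2].
  have /choice[s sP] : forall i, exists s : 'I_t' * A * A,
      [/\ s.1.2 * s.2 = 1, s.2 * s.1.2 = 1 & b i = s.1.2 * b' s.1.1 * s.2].
    by move=> i; have [j [u [v ?]]] := fb' _ (pb i); exists (j, u, v).
  by exists s.
pose sg i := (s i).1.1; pose p i := (s i).2 * b i; pose q i := b i * (s i).1.2.
have csg i : conj_idem (b' (sg i)) (b i).
  by exists (s i).1.2, (s i).2; exact: sP.
have [ta taP] : exists ta : 'I_t' -> 'I_t, forall j,
    conj_idem (b (ta j)) (b' j).
  by have /choice[ta taP] := fun j => fb _ (pb' j); exists ta.
(* Going to the other family and back stays in one conjugacy class, and each class has a single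
   representative in a family. *)
have sgK : cancel sg ta.
  by move=> i; apply: cb; apply: conj_idem_trans (taP _) (csg _).
have taK : cancel ta sg.
  by move=> j; apply: cb'; apply: conj_idem_trans (csg _) (taP _).
have sumsg : \sum_i b' (sg i) = \sum_j b' j.
  by rewrite [RHS](reindex sg) //; exists ta => ? _.
have defp i : p i = b' (sg i) * (s i).2.
  have [uv vu def_b] := sP i.
  by rewrite /sg /p def_b !mulrA vu mul1r.
have defq i : q i = (s i).1.2 * b' (sg i).
  have [uv vu def_b] := sP i; rewrite /sg /q def_b.
  by rewrite -mulrA vu mulr1.
have pq i j : p i * q j = if i == j then b' (sg i) else 0.
  have [<-|ij] := eqVneq i j; last first.
    by rewrite /p /q !mulrA -(mulrA _ (b i)) ob // mulr0 mul0r.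
  have [uv vu _] := sP i.
  by rewrite defp defq !mulrA -(mulrA _ (s i).2) vu mulr1 bb'.
have qp i j : q i * p j = if i == j then b i else 0.
  have [<-|ij] := eqVneq i j; last first.
    rewrite defp defq mulrA -(mulrA (s i).1.2) ob' ?mulr0 ?mul0r //.
    by rewrite (inj_eq (can_inj sgK)).
  have [uv vu _] := sP i.
  by rewrite /p /q !mulrA -(mulrA _ (s i).1.2) uv mulr1 bb.
(* Each of the six required products is a double sum whose terms off the diagonal vanish. *)
have ortho (c : 'I_t -> A) (r : 'I_t -> A) :
    (forall i j, c i * r j = if i == j then c i * r i else 0) ->
    (\sum_i c i) * (\sum_i r i) = \sum_i c i * r i.
  move=> cr; rewrite mulr_suml; apply: eq_bigr => i _.
  rewrite mulr_sumr (bigD1 i) //= big1 ?addr0 // => j.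
  by rewrite cr eq_sym => /negPf->.
exists (\sum_i p i), (\sum_i q i); rewrite -sumsg.
do !split; rewrite ortho => [|i j].
all: rewrite ?pq ?qp ?eqxx //.
- by apply: eq_bigr => i _; rewrite pq eqxx.
- by apply: eq_bigr => i _; rewrite qp eqxx.
- by apply: eq_bigr => i _; rewrite defp mulrA bb'.
- rewrite !defp !mulrA bb'; case: eqVneq => [->|ij]; first by rewrite bb'.
  by rewrite ob' ?mul0r // (inj_eq (can_inj sgK)).
- by apply: eq_bigr => i _; rewrite /p -mulrA bb.
- rewrite /p -!mulrA bb; case: eqVneq => [->|ij]; first by rewrite bb.
  by rewrite ob ?mulr0.
- by apply: eq_bigr => i _; rewrite /q mulrA bb.
- rewrite /q !mulrA bb; case: eqVneq => [->|ij]; first by rewrite bb.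
  by rewrite ob ?mul0r.
- by apply: eq_bigr => i _; rewrite defq -mulrA bb'.
rewrite !defq -!mulrA bb'; case: eqVneq => [->|ij]; first by rewrite bb'.
by rewrite ob' ?mulr0 // (inj_eq (can_inj sgK)).
Qed.

End PrimitiveIdempotents.

Section IdempotentTransport.
Variables (k : fieldType) (A B : algType k) (f : {lrmorphism A -> B}).
Hypothesis f_bij : bijective f.

Lemma conj_idem_morph e e' : conj_idem e e' -> conj_idem (f e) (f e').
Proof.
case=> u [v [uv vu ->]]; exists (f u), (f v).
by rewrite -!rmorphM uv vu rmorph1.
Qed.

Lemma primitive_idem_morph e : primitive_idem e -> primitive_idem (f e).
Proof.
move=> pe; have [g fK gK] := lrmorphism_inv f_bij; have [e0 ee _] := pe.
apply: primitive_idemI.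
- by apply: contra e0; rewrite -(rmorph0 f) (inj_eq (can_inj fK)).
- by rewrite -rmorphM ee.
move=> x xx ex xe; case: (@primitive_idem_sub _ e (g x) pe) => [| | |x0|gx].
- by rewrite -rmorphM xx.
- by rewrite -{1}(fK e) -rmorphM ex.
- by rewrite -{1}(fK e) -rmorphM xe.
- by left; rewrite -(gK x) x0 rmorph0.
by right; rewrite -gx gK.
Qed.

End IdempotentTransport.

Section CornerIsomorphism.
Variables (k : fieldType).

(** [F] and [G] live on the ambient algebras and are constrained on the corners only, so that uses
    of this lemma never handle the subtypes. *)
Lemma corner_iso_corner (A B : algType k) (e : nzidem A) (e' : nzidem B)
    (F : {linear A -> B}) (G : B -> A) :
  let: c := idem_val e in let: c' := idem_val e' in
  F c = c' ->
  (forall a, c * a * c = a -> c' * F a * c' = F a) ->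
  (forall a b, c * a * c = a -> c * b * c = b -> F (a * b) = F a * F b) ->
  (forall b, c' * b * c' = b -> c * G b * c = G b) ->
  (forall a, c * a * c = a -> G (F a) = a) ->
  (forall b, c' * b * c' = b -> F (G b) = b) ->
  alg_iso (corner e) (corner e').
Proof.
move=> F1 Fc FM Gc FK GK.
have inP (x : corner e) : idem_val e * val x * idem_val e = val x.
  by apply/eqP; exact: valP x.
have inP' (x : corner e') : idem_val e' * val x * idem_val e' = val x.
  by apply/eqP; exact: valP x.
have subF (x : corner e) : in_corner e' (F (val x)).
  by apply/eqP/Fc/inP.
have subG (x : corner e') : in_corner e (G (val x)).
  by apply/eqP/Gc/inP'.
pose h x : corner e' := Sub (F (val x)) (subF x).
pose h' x : corner e := Sub (G (val x)) (subG x).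
apply: (@alg_isoI _ _ _ h).
- by move=> c x y; apply: val_inj; rewrite /= linearP.
- split=> [|x y]; apply: val_inj; first exact: F1.
  exact: FM (inP x) (inP y).
exists h' => x; apply: val_inj => /=; first exact: FK (inP x).
exact: GK (inP' x).
Qed.

Lemma corner_iso (A B : algType k) (e : nzidem A)
    (F : {linear A -> B}) (G : B -> A) :
  let: c := idem_val e in
  F c = 1 ->
  (forall a b, c * a * c = a -> c * b * c = b -> F (a * b) = F a * F b) ->
  (forall b, c * G b * c = G b) ->
  (forall a, c * a * c = a -> G (F a) = a) ->
  cancel G F ->
  alg_iso (corner e) B.
Proof.
move=> F1 FM Gc FK GK.
have inP (x : corner e) : idem_val e * val x * idem_val e = val x.
  by apply/eqP; exact: valP x.
have subG x : in_corner e (G x) by apply/eqP/Gc.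
apply: (@alg_isoI _ _ _ (fun x : corner e => F (val x))).
- by move=> c x y; rewrite /= linearP.
- by split=> [|x y]; [exact: F1 | exact: FM (inP x) (inP y)].
exists (fun x => Sub (G x) (subG x)) => x; last exact: GK.
by apply: val_inj; exact: FK (inP x).
Qed.

(** The basic algebra is well defined: with [x y = e'] and [y x = e], the maps [a |-> x a y] and
    [a |-> y a x] are inverse to each other on the corners. *)
Lemma basic_corner_iso (A : algType k) (e e' : nzidem A) t t'
    (b : 'I_t -> A) (b' : 'I_t' -> A) :
  basic_family b -> basic_family b' ->
  idem_val e = \sum_i b i -> idem_val e' = \sum_i b' i ->
  alg_iso (corner e) (corner e').
Proof.
move=> bb bb' ee ee'.
have [x [y [[xy yx ex xe] [ey ye]]]] := basic_family_equiv bb bb'.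
rewrite -ee -ee' in xy yx ex xe ey ye.
have lF : linear (fun a => x * a * y).
  by move=> c a a'; rewrite mulrDr mulrDl -scalerAr -scalerAl.
pose F : {linear A -> A} := HB.pack (fun a => x * a * y)
  (GRing.isLinear.Build k A A _ (fun a => x * a * y) lF).
apply: (@corner_iso_corner _ _ e e' F (fun a => y * a * x)) =>
  [|a _|a a' ha ha'|a _|a ha|a ha] /=.
- by rewrite xe.
- by rewrite !mulrA ex -!mulrA ye.
(* The inner factor [y x = e] of [x a y x a' y] is absorbed by [a]. *)
- have ae : a * idem_val e = a by rewrite -ha -mulrA idem_mul.
  by rewrite !mulrA -(mulrA _ y x) yx -(mulrA x a (idem_val e)) ae.
- by rewrite !mulrA ey -!mulrA xe.
- by rewrite !mulrA yx -!mulrA yx mulrA.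
- by rewrite !mulrA xy -!mulrA xy mulrA.
Qed.

End CornerIsomorphism.

(** * Morita equivalence with a full corner *)

Section CornerModule.
Variables (k : fieldType) (A : algType k) (e : nzidem A).
Local Notation c := (idem_val e).

Lemma to_corner_subproof a : in_corner e (c * a * c).
Proof. by apply/eqP; rewrite !mulrA idem_mul -!mulrA idem_mul. Qed.

(** The compression of [A] onto [eAe] is additive but not multiplicative; the extra idempotent in
    [to_cornerM] is what the relation [xy1] below absorbs. *)
Definition to_corner a : corner e := Sub (c * a * c) (to_corner_subproof a).

Lemma to_cornerD a b : to_corner (a + b) = to_corner a + to_corner b.
Proof. by apply: val_inj; rewrite /= mulrDr mulrDl. Qed.

Lemma to_corner_sum (I : finType) (F : I -> A) :
  to_corner (\sum_i F i) = \sum_i to_corner (F i).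
Proof.
apply: (big_morph to_corner to_cornerD).
by apply: val_inj; rewrite /= mulr0 mul0r.
Qed.

Lemma to_cornerM a b : to_corner a * to_corner b = to_corner (a * c * b).
Proof. by apply: val_inj; rewrite /= !mulrA -(mulrA _ c c) idem_mul. Qed.

Section Fix.
Variable V : lmodType A.

Definition in_fix : {pred V} := [pred v | c *: v == v].

Let fix_zmod : zmod_closed in_fix.
Proof.
split=> [|u v /eqP hu /eqP hv]; first by rewrite inE scaler0.
by rewrite inE scalerBr hu hv.
Qed.
HB.instance Definition _ := GRing.isZmodClosed.Build V in_fix fix_zmod.

(** This is [eV]. Only its additive structure is inherited from [V], because the scalars change from
    [A] to [eAe]. *)
Definition fix_mod : Type := {v : V | in_fix v}.
HB.instance Definition _ := SubChoice.on fix_mod.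
HB.instance Definition _ := [SubChoice_isSubZmodule of fix_mod by <:].

Lemma fixE (v : fix_mod) : c *: val v = val v.
Proof. by apply/eqP; exact: valP v. Qed.

Let scale_subproof (a : corner e) (v : fix_mod) : in_fix (val a *: val v).
Proof. by apply/eqP; rewrite scalerA corner_mull. Qed.
Definition fix_scale (a : corner e) (v : fix_mod) : fix_mod :=
  Sub (val a *: val v) (scale_subproof a v).

Let scaleA a b v : fix_scale a (fix_scale b v) = fix_scale (a * b) v.
Proof. by apply: val_inj; rewrite /= scalerA. Qed.
Let scale1 : left_id 1 fix_scale.
Proof. by move=> v; apply: val_inj; rewrite /= fixE. Qed.
Let scaleDr : right_distributive fix_scale +%R.
Proof. by move=> a u v; apply: val_inj; rewrite /= scalerDr. Qed.
Let scaleDl v : {morph fix_scale^~ v : a b / a + b}.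
Proof. by move=> a b; apply: val_inj; rewrite /= scalerDl. Qed.
HB.instance Definition _ := GRing.Zmodule_isLmodule.Build (corner e) fix_mod
  scaleA scale1 scaleDr scaleDl.

Lemma val_fixZ (a : corner e) (v : fix_mod) : val (a *: v) = val a *: val v.
Proof. by []. Qed.

End Fix.

Section FixMap.
Variables (U V : lmodType A) (f : {linear U -> V}).

Let fix_map_subproof (u : fix_mod U) : in_fix (f (val u)).
Proof. by apply/eqP; rewrite -linearZ /= fixE. Qed.
Definition fix_map (u : fix_mod U) : fix_mod V :=
  Sub (f (val u)) (fix_map_subproof u).
Let fix_map_linear : linear fix_map.
Proof. by move=> a u v; apply: val_inj; rewrite /= linearP. Qed.
HB.instance Definition _ :=
  GRing.isLinear.Build (corner e) _ _ _ fix_map fix_map_linear.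

End FixMap.

Definition fix_functor : mod_functor A (corner e).
Proof.
refine (@ModFunctor k A (corner e) (fun V => fix_mod V : lmodType (corner e))
  (fun U V f => fix_map f : {linear _ -> _}) _ _ _ _).
- by move=> U f idf v; apply: val_inj; rewrite /= idf.
- by move=> U V W f g h fg v; apply: val_inj; rewrite /= fg.
- by move=> U V f g h fg v; apply: val_inj; rewrite /= fg.
(* The scalar [a] is [a *: e] in the corner, so [e] is introduced by writing [v = e v]. *)
move=> U V a f h fh v; apply: val_inj; rewrite /= fh -{1}[val v]fixE.
by rewrite linearZ /= scalerA -scalerAl mul1r.
Defined.

(* [x_i], [y_i] exhibit [A] as a corner of a matrix algebra over [eAe], so that
   an [eAe]-module [W] gives an [A]-module inside [W^m]. *)
Variables (m : nat) (x y : 'I_m -> A).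
Hypothesis xy1 : \sum_i x i * c * y i = 1.

Local Notation coef i a j := (to_corner (y i * a * x j)).

(** Inserting [xy1] between [a] and [b] shows that [A] acts by matrices over [eAe]. *)
Let coefM i a b l : \sum_j coef i a j * coef j b l = coef i (a * b) l.
Proof.
under eq_bigr do rewrite to_cornerM.
rewrite -to_corner_sum; congr to_corner.
rewrite -[in RHS](mulr1 a) -xy1 !(mulr_sumr, mulr_suml).
by apply: eq_bigr => j _; rewrite !mulrA.
Qed.

Section Ind.
Variable W : lmodType (corner e).

(** The matrix of 1 is an idempotent, in general not the identity. Its fixed vectors are a concrete
    model of [Ae] tensored with [W] over [eAe]. *)
Definition in_ind : {pred {ffun 'I_m -> W}} :=
  [pred w : {ffun 'I_m -> W} | [forall i, \sum_j coef i 1 j *: w j == w i]].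

Let ind_zmod : zmod_closed in_ind.
Proof.
split=> [|u v /forallP hu /forallP hv]; apply/forallP => i.
  by rewrite big1 ?ffunE // => j _; rewrite ffunE scaler0.
rewrite !ffunE -(eqP (hu i)) -(eqP (hv i)) -sumrB; apply/eqP/eq_bigr => j _.
by rewrite !ffunE scalerBr.
Qed.
HB.instance Definition _ :=
  GRing.isZmodClosed.Build {ffun 'I_m -> W} in_ind ind_zmod.

Definition ind_mod : Type := {w : {ffun 'I_m -> W} | in_ind w}.
HB.instance Definition _ := SubChoice.on ind_mod.
HB.instance Definition _ := [SubChoice_isSubZmodule of ind_mod by <:].

Lemma indE (w : ind_mod) i : \sum_j coef i 1 j *: val w j = val w i.
Proof. by have /forallP/(_ i)/eqP := valP w. Qed.

Let act a (w : 'I_m -> W) i := \sum_j coef i a j *: w j.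

Let actM a b w i : act a (act b w) i = act (a * b) w i.
Proof.
rewrite /act; under eq_bigr do rewrite scaler_sumr.
rewrite exchange_big; apply: eq_bigr => l _ /=.
by rewrite -coefM scaler_suml; apply: eq_bigr => j _; rewrite scalerA.
Qed.

Let scale_subproof a (w : ind_mod) : in_ind [ffun i => act a (val w) i].
Proof.
apply/forallP => i; rewrite ffunE; apply/eqP; rewrite -[in RHS](mul1r a) -actM.
by apply: eq_bigr => j _; rewrite ffunE.
Qed.
Definition ind_scale a w : ind_mod := Sub _ (scale_subproof a w).

Lemma val_ind_scale a w i :
  val (ind_scale a w) i = \sum_j coef i a j *: val w j.
Proof. by rewrite /= ffunE. Qed.

Let scaleA a b v : ind_scale a (ind_scale b v) = ind_scale (a * b) v.
Proof.
apply: val_inj; apply/ffunP => i; rewrite !val_ind_scale -[RHS]actM.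
by apply: eq_bigr => j _; rewrite val_ind_scale.
Qed.
Let scale1 : left_id 1 ind_scale.
Proof.
by move=> w; apply: val_inj; apply/ffunP => i; rewrite val_ind_scale indE.
Qed.
Let scaleDr : right_distributive ind_scale +%R.
Proof.
move=> a u v; apply: val_inj; apply/ffunP => i; rewrite /= !ffunE -big_split.
by apply: eq_bigr => j _; rewrite ffunE scalerDr.
Qed.
Let scaleDl v : {morph ind_scale^~ v : a b / a + b}.
Proof.
move=> a b; apply: val_inj; apply/ffunP => i; rewrite /= !ffunE -big_split.
by apply: eq_bigr => j _; rewrite mulrDr mulrDl to_cornerD scalerDl.
Qed.
HB.instance Definition _ := GRing.Zmodule_isLmodule.Build A ind_mod
  scaleA scale1 scaleDr scaleDl.

Lemma val_indZ a (w : ind_mod) i :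
  val (a *: w) i = \sum_j coef i a j *: val w j.
Proof. exact: val_ind_scale. Qed.

End Ind.

Section IndMap.
Variables (U V : lmodType (corner e)) (f : {linear U -> V}).

Let ind_map_subproof (u : ind_mod U) : in_ind [ffun i => f (val u i)].
Proof.
apply/forallP => i; rewrite ffunE -indE linear_sum; apply/eqP.
by apply: eq_bigr => j _; rewrite ffunE linearZ.
Qed.
Definition ind_map (u : ind_mod U) : ind_mod V := Sub _ (ind_map_subproof u).
Lemma val_ind_map u i : val (ind_map u) i = f (val u i).
Proof. by rewrite /= ffunE. Qed.
Let ind_map_linear : linear ind_map.
Proof.
move=> a u v; apply: val_inj; apply/ffunP => i.
rewrite [LHS]val_ind_map [RHS]ffunE val_ind_map ffunE linearD val_indZ.
rewrite val_indZ linear_sum; congr (_ + _).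
by apply: eq_bigr => j _; rewrite val_ind_map linearZ.
Qed.
HB.instance Definition _ :=
  GRing.isLinear.Build A _ _ _ ind_map ind_map_linear.

End IndMap.

Definition ind_functor : mod_functor (corner e) A.
Proof.
refine (@ModFunctor k (corner e) A (fun V => ind_mod V : lmodType A)
  (fun U V f => ind_map f : {linear _ -> _}) _ _ _ _).
- move=> U f idf v; apply: val_inj; apply/ffunP => i.
  by rewrite val_ind_map idf.
- move=> U V W f g h fg v; apply: val_inj; apply/ffunP => i.
  by rewrite /= !ffunE fg.
- move=> U V f g h fg v; apply: val_inj; apply/ffunP => i.
  by rewrite /= !ffunE fg.
move=> U V a f h fh v; apply: val_inj; apply/ffunP => i.
rewrite val_indZ [LHS]ffunE fh -indE linear_sum scaler_sumr.
apply: eq_bigr => j _; rewrite linearZ /= ffunE !scalerA; congr (_ *: _).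
apply: val_inj; rewrite /= -!scalerAr -!scalerAl -scalerAr -!scalerAl.
by congr (_ *: _); rewrite !mulrA idem_mul.
Defined.

Section Unit.
Variable V : lmodType A.

Let unit_fun_subproof i (v : V) : in_fix (c *: (y i *: v)).
Proof. by apply/eqP; rewrite scalerA idem_mul. Qed.
Definition unit_fun (v : V) : {ffun 'I_m -> fix_mod V} :=
  [ffun i => Sub (c *: (y i *: v)) (unit_fun_subproof i v)].

(** The case [a = 1] places the family in [in_ind]; general [a] gives linearity. *)
Let unit_funE a (v : V) i :
  \sum_j coef i a j *: unit_fun v j = unit_fun (a *: v) i.
Proof.
apply: val_inj; rewrite !ffunE raddf_sum /= !scalerA.
under eq_bigr do rewrite ffunE /= !scalerA.
rewrite -scaler_suml; congr (_ *: _).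
rewrite -[RHS]mulr1 -xy1 mulr_sumr.
by apply: eq_bigr => j _; rewrite !mulrA -(mulrA _ c c) idem_mul.
Qed.

Let ind_unit_subproof (v : V) : in_ind (unit_fun v).
Proof. by apply/forallP => i; rewrite unit_funE scale1r. Qed.
Definition ind_unit (v : V) : ind_mod (fix_mod V) :=
  Sub (unit_fun v) (ind_unit_subproof v).

Let ind_unit_linear : linear ind_unit.
Proof.
move=> a u v; apply: val_inj; apply/ffunP => i.
rewrite [RHS]ffunE val_indZ unit_funE !ffunE.
by apply: val_inj; rewrite /= ?scalerDr.
Qed.
HB.instance Definition _ :=
  GRing.isLinear.Build A _ _ _ ind_unit ind_unit_linear.

(** The inverse sends [(w_i)] to the sum of the [x_i w_i]: one composite is the identity by [xy1],
    the other by the equation that defines [in_ind]. *)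
Lemma ind_unit_bij : bijective ind_unit.
Proof.
exists (fun w : ind_mod (fix_mod V) => \sum_i x i *: val (val w i)) => [v|w].
  under eq_bigr do rewrite ffunE /= !scalerA.
  by rewrite -scaler_suml -[RHS]scale1r -xy1.
apply: val_inj; apply/ffunP => i; rewrite ffunE -[RHS]indE; apply: val_inj.
rewrite SubK [RHS]raddf_sum /= !scaler_sumr. apply: eq_bigr => j _.
by rewrite -[in LHS]fixE !scalerA !mulrA mulr1.
Qed.

End Unit.

Section Counit.
Variable W : lmodType (corner e).

Definition counit_fun (w : W) : {ffun 'I_m -> W} :=
  [ffun i => to_corner (y i) *: w].

Let counit_funE a (w : W) i :
  \sum_j coef i a j *: counit_fun w j = to_corner (y i * a) *: w.
Proof.
under eq_bigr do rewrite ffunE scalerA to_cornerM.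
rewrite -scaler_suml -to_corner_sum; congr (to_corner _ *: _).
rewrite -[RHS]mulr1 -xy1 mulr_sumr.
by apply: eq_bigr => j _; rewrite !mulrA.
Qed.

Let counit_subproof (w : W) : in_ind (counit_fun w).
Proof. by apply/forallP => i; rewrite counit_funE mulr1 ffunE. Qed.
Definition counit_ind (w : W) : ind_mod W :=
  Sub (counit_fun w) (counit_subproof w).

Let to_corner_c a (b : corner e) : to_corner (a * val b) = to_corner a * b.
Proof. by apply: val_inj; rewrite /= -!mulrA corner_mulr corner_mull. Qed.

Let counit_fix (w : W) : in_fix (counit_ind w).
Proof.
apply/eqP/val_inj/ffunP => i; rewrite val_indZ counit_funE ffunE.
by congr (_ *: _); apply: val_inj; rewrite /= -!mulrA !idem_mul.
Qed.
Definition fix_counit (w : W) : fix_mod (ind_mod W) :=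
  Sub (counit_ind w) (counit_fix w).

Let fix_counit_linear : linear fix_counit.
Proof.
move=> b u v; apply: val_inj; apply: val_inj; apply/ffunP => i.
rewrite [RHS]ffunE val_fixZ val_indZ counit_funE to_corner_c.
by rewrite !ffunE scalerDr scalerA.
Qed.
HB.instance Definition _ :=
  GRing.isLinear.Build (corner e) _ _ _ fix_counit fix_counit_linear.

(** The inverse sends [(w_i)] to the sum of the [(e x_i e) w_i]. One composite is the compression of
    [xy1]; the other is the action of [e] on a vector that [e] fixes. *)
Lemma fix_counit_bij : bijective fix_counit.
Proof.
exists (fun w : fix_mod (ind_mod W) =>
  \sum_i to_corner (x i) *: val (val w) i) => [w|w].
  under eq_bigr do rewrite ffunE scalerA to_cornerM.
  rewrite -scaler_suml -to_corner_sum xy1 -[RHS]scale1r; congr (_ *: _).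
  by apply: val_inj; rewrite /= mulr1 idem_mul.
apply: val_inj; apply: val_inj; apply/ffunP => i.
rewrite ffunE -[in RHS]fixE val_indZ scaler_sumr.
by apply: eq_bigr => j _; rewrite scalerA to_cornerM.
Qed.

End Counit.

(** The relation [xy1] says that [e] is full, that is [A e A = A]. *)
Theorem morita_corner : morita_equivalent A (corner e).
Proof.
exists fix_functor, ind_functor,
  (fun V => ind_unit (V := V) : {linear _ -> _}),
  (fun W => fix_counit (W := W) : {linear _ -> _}); split.
- exact: ind_unit_bij.
- move=> U V f u; apply: val_inj; apply/ffunP => i; apply: val_inj.
  by rewrite /= !ffunE /= !linearZ.
- exact: fix_counit_bij.
move=> U W f u; apply: val_inj; apply: val_inj; apply/ffunP => i.
by rewrite /= !ffunE linearZ.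
Qed.

End CornerModule.

(** * The monoid algebra as a block algebra *)

(** By rank and nullity; with this a one-sided inverse of the representation of the monoid algebra
    is enough. *)
Lemma dim_inj_bij (K : fieldType) (U V : vectType K) (f : U -> V) :
  linear f -> dim U = dim V -> injective f -> bijective f.
Proof.
move=> lf dimUV inj_f.
pose F : {linear U -> V} := HB.pack f (GRing.isLinear.Build K U V _ f lf).
have kerF : lker (linfun F) == 0%VS.
  by apply/lker0P => u v; rewrite !lfunE => /inj_f.
have imF : limg (linfun F) = fullv.
  apply/eqP; rewrite eqEdim subvf limg_dim_eq; last by rewrite (eqP kerF) capv0.
  by rewrite !dimvf dimUV leqnn.
exists (linfun F)^-1%VF => [u|v]; first by rewrite -[f u](lfunE F) lker0_lfunK.
by rewrite -[LHS](lfunE F) limg_lfunVK // imF memvf.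
Qed.

Section MonoidAlgebraLift.
Variables (k : fieldType) (M : finMonoidType) (B : algType k) (phi : M -> B).
Hypothesis phi1 : phi 1%g = 1.
Hypothesis phiM : forall m n, phi (m * n)%g = phi m * phi n.

Definition monoid_alg_lift (x : monoid_alg k M) : B := \sum_m x m *: phi m.

Lemma monoid_alg_lift_linear : linear monoid_alg_lift.
Proof.
move=> c x y; rewrite scaler_sumr -big_split; apply: eq_bigr => m _ /=.
by rewrite !ffunE scalerDl scalerA.
Qed.

(** The universal property of the monoid algebra: the double sum over pairs is regrouped according
    to their product in [M]. *)
Lemma monoid_alg_lift_morph : monoid_morphism monoid_alg_lift.
Proof.
split=> [|x y].
  rewrite /monoid_alg_lift (bigD1 1%g) //= ffunE eqxx scale1r phi1.
  rewrite big1 ?addr0 //.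
  by move=> m /negPf m1; rewrite ffunE m1 scale0r.
rewrite /monoid_alg_lift mulr_suml.
under [RHS]eq_bigr do rewrite mulr_sumr.
rewrite pair_bigA (partition_big (fun p => (p.1 * p.2)%g) xpredT) //=.
apply: eq_bigr => m _; rewrite ffunE scaler_suml; apply: eq_bigr => p /eqP <-.
by rewrite phiM -scalerAl -scalerAr scalerA.
Qed.

End MonoidAlgebraLift.

(** * Matrices of size two in terms of their entries *)

Section Matrix2.
Variable R : comPzRingType.

Definition row2 (x y : R) : 'rV[R]_2 := \row_j (if j == 0 then x else y).
Definition col2 (x y : R) : 'cV[R]_2 := \col_i (if i == 0 then x else y).
Definition mx2 (a b c d : R) : 'M[R]_2 :=
  \matrix_(i, j) (if i == 0 then if j == 0 then a else b
                  else if j == 0 then c else d).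

Lemma mulmx2E m n (A : 'M[R]_(m, 2)) (B : 'M[R]_(2, n)) i j :
  (A *m B) i j = A i 0 * B 0 j + A i 1 * B 1 j.
Proof.
rewrite mxE big_ord_recl big_ord1; congr (_ + A i _ * B _ j); exact: val_inj.
Qed.

Lemma mx2_mul a b c d a' b' c' d' :
  mx2 a b c d *m mx2 a' b' c' d' =
  mx2 (a * a' + b * c') (a * b' + b * d') (c * a' + d * c') (c * b' + d * d').
Proof.
apply/matrixP => i j; rewrite mulmx2E !mxE /=.
by case: (i == 0); case: (j == 0).
Qed.

Lemma row2_mul x y a b c d :
  row2 x y *m mx2 a b c d = row2 (x * a + y * c) (x * b + y * d).
Proof.
by apply/matrixP => i j; rewrite mulmx2E !mxE /=; case: (j == 0).
Qed.

Lemma col2_mul x y a b c d :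
  mx2 a b c d *m col2 x y = col2 (a * x + b * y) (c * x + d * y).
Proof.
by apply/matrixP => i j; rewrite mulmx2E !mxE /=; case: (i == 0).
Qed.

Lemma row2D x y x' y' : row2 x y + row2 x' y' = row2 (x + x') (y + y').
Proof. by apply/matrixP => i j; rewrite !mxE; case: (j == 0). Qed.

Lemma col2D x y x' y' : col2 x y + col2 x' y' = col2 (x + x') (y + y').
Proof. by apply/matrixP => i j; rewrite !mxE; case: (i == 0). Qed.

Lemma row2Z c x y : c *: row2 x y = row2 (c * x) (c * y).
Proof. by apply/matrixP => i j; rewrite !mxE; case: (j == 0). Qed.

Lemma col2Z c x y : c *: col2 x y = col2 (c * x) (c * y).
Proof. by apply/matrixP => i j; rewrite !mxE; case: (i == 0). Qed.

Lemma mx2_1 : 1%:M = mx2 1 0 0 1.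
Proof.
by apply/matrixP => i j; rewrite !mxE; case: i j => [[|[|]] // ?] [[|[|]] // ?].
Qed.

Lemma row2_0 : row2 0 0 = 0.
Proof. by apply/matrixP => i j; rewrite !mxE; case: (j == 0). Qed.

Lemma col2_0 : col2 0 0 = 0.
Proof. by apply/matrixP => i j; rewrite !mxE; case: (i == 0). Qed.

Lemma col2_eta (C : 'cV[R]_2) : C = col2 (C 0 0) (C 1 0).
Proof.
by apply/matrixP => p q; rewrite [RHS]mxE ord1; case: p => [[|[|]] // ?] /=;
  congr (C _ _); apply: val_inj.
Qed.

Lemma row2_eta (v : 'rV[R]_2) : v = row2 (v 0 0) (v 0 1).
Proof.
by apply/matrixP => p q; rewrite [RHS]mxE ord1; case: q => [[|[|]] // ?] /=;
  congr (v _ _); apply: val_inj.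
Qed.

End Matrix2.

(** Reading elements of the field with two elements as bits turns polynomial identities over it into
    Boolean ones, which can be decided by enumeration. *)
Lemma F2_addb (x y : 'F_2) : (x + y != 0) = (x != 0) (+) (y != 0).
Proof. by case: x => [[|[|]]] // ?; case: y => [[|[|]]]. Qed.

Lemma F2_mulb (x y : 'F_2) : (x * y != 0) = (x != 0) && (y != 0).
Proof. by rewrite mulf_eq0 negb_or. Qed.

Lemma F2_inj : injective (fun x : 'F_2 => x != 0).
Proof.
by case=> [[|[|]]] // ? [[|[|]]] // ? h; apply: val_inj.
Qed.

Definition entry (m : M22) i j : bool := (m : 'M['F_2]_2) i j != 0.

Lemma entryM m n i j :
  entry (m * n)%g i j =
  (entry m i 0 && entry n 0 j) (+) (entry m i 1 && entry n 1 j).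
Proof.
have -> : entry (m * n)%g i j = (((m : 'M_2) *m n) i j != 0) by [].
by rewrite mulmx2E F2_addb !F2_mulb.
Qed.

Lemma entry1 i j : entry 1%g i j = (i == j).
Proof. by rewrite /entry mxE; case: (i == j). Qed.

Lemma entry_inj m n : entry m 0 0 = entry n 0 0 -> entry m 0 1 = entry n 0 1 ->
  entry m 1 0 = entry n 1 0 -> entry m 1 1 = entry n 1 1 -> m = n.
Proof.
have I2 (i : 'I_2) : i = 0 \/ i = 1.
  by case: i => [[|[|]] // ?]; [left | right]; apply: val_inj.
by move=> ? ? ? ?; apply/matrixP => i j; case: (I2 i) => ->; case: (I2 j) => ->;
  apply: F2_inj.
Qed.

(* A matrix [[a, b], [c, d]] of rank one over $\mathbb F_2$ is [C R] for unique
   nonzero vectors [C = (col1, col2)] and [R = (row1, row2)]. *)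
Section BitFunctions.
Variables a b c d : bool.
Definition bdet := (a && d) (+) (b && c).
(** The transpositions of $GL_2(\mathbb F_2) \cong S_3$ are the invertible matrices of trace 0 other
    than the identity. *)
Definition bsign := bdet && ((a == d) && (b || c)).
Definition brk1 := ~~ bdet && [|| a, b, c | d].
Definition brow1 := brk1 && (a || c).
Definition brow2 := brk1 && (b || d).
Definition bcol1 := brk1 && (a || b).
Definition bcol2 := brk1 && (c || d).
End BitFunctions.

Section Representation.
Variables (k : fieldType).
Hypothesis char2 : 2%N \in [pchar k].

Local Notation "b %:K" := ((nat_of_bool b)%:R : k) (at level 2).

(** Characteristic 2 enters here: the field with two elements embeds in [k]. *)
Lemma natr_addb b b' : (b (+) b')%:K = b%:K + b'%:K.
Proof.
by case: b b' => [] []; rewrite ?addr0 ?add0r //= -natrD (pcharf0 char2).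
Qed.

Lemma natr_andb b b' : (b && b')%:K = b%:K * b'%:K.
Proof. by case: b b' => [] []; rewrite /= ?(mulr0, mul0r, mulr1). Qed.

Definition bits_rep a b c d : block_alg k 2 :=
  blk (bdet a b c d)%:K (bsign a b c d)%:K (brk1 a b c d)%:K
    (row2 (brow1 a b c d)%:K (brow2 a b c d)%:K)
    (col2 (bcol1 a b c d)%:K (bcol2 a b c d)%:K)
    (mx2 a%:K b%:K c%:K d%:K)
    (mx2 (bdet a b c d && a)%:K (bdet a b c d && b)%:K
      (bdet a b c d && c)%:K (bdet a b c d && d)%:K) 1.

Lemma dot_row2_col2 x y x' y' :
  dot (row2 x y) (col2 x' y') = x * x' + y * y' :> k.
Proof. by rewrite /dot mulmx2E !mxE. Qed.

(** For the coordinate [g], the sign is additive on products of invertible matrices. For [z], the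
    product [(C R)(C' R') = (R C') C R'] has rank one exactly when [R C' = 1], while an invertible
    factor preserves the rank. *)
Lemma bits_repM a b c d a' b' c' d' :
  bits_rep a b c d * bits_rep a' b' c' d' =
  bits_rep (a && a' (+) b && c') (a && b' (+) b && d')
    (c && a' (+) d && c') (c && b' (+) d && d').
Proof.
rewrite blkM !(dot_row2_col2, row2_mul, col2_mul, mx2_mul, row2Z, col2Z, row2D,
  col2D).
rewrite -!natr_andb -!natr_addb mulr1.
apply: blk_eq; do ?[congr (row2 _ _) | congr (col2 _ _) | congr (mx2 _ _ _ _)];
  try congr ((nat_of_bool _)%:R).
(* Every coordinate is now an identity between Boolean functions of the eight entries. *)
all: by move: a b c d a' b' c' d' => [] [] [] [] [] [] [] [].
Qed.

Definition M22_rep (m : M22) : block_alg k 2 :=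
  bits_rep (entry m 0 0) (entry m 0 1) (entry m 1 0) (entry m 1 1).

Lemma M22_repM m n : M22_rep (m * n)%g = M22_rep m * M22_rep n.
Proof. by rewrite bits_repM /M22_rep !entryM. Qed.

Lemma M22_rep1 : M22_rep 1%g = 1.
Proof.
rewrite /M22_rep !entry1 /= /bits_rep /= row2_0 col2_0 -mx2_1.
by [].
Qed.

(* The coefficient at [[a, b], [c, d]] of the inverse image of [x]: on
   $GL_2(\mathbb F_2)$ the indicator of the identity is $1 + s + tr$, and on
   nonzero vectors over $\mathbb F_2$ that of [r] is $u \mapsto 1 + det(r, u)$. *)
Definition bits_coef a b c d (x : block_alg k 2) : k :=
  let: (al, g, z, w, v, M, N, t) := x in
  if bdet a b c d then
    al + (bsign a b c d)%:K * al + g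
    + d%:K * N 0 0 + b%:K * N 1 0 + c%:K * N 0 1 + a%:K * N 1 1
  else if brk1 a b c d then
    z + w 0 0 * (brow2 a b c d)%:K + w 0 1 * (brow1 a b c d)%:K
    + v 0 0 * (bcol2 a b c d)%:K + v 1 0 * (bcol1 a b c d)%:K
    + (M 0 0 + N 0 0) * (bcol2 a b c d && brow2 a b c d)%:K
    + (M 0 1 + N 0 1) * (bcol2 a b c d && brow1 a b c d)%:K
    + (M 1 0 + N 1 0) * (bcol1 a b c d && brow2 a b c d)%:K
    + (M 1 1 + N 1 1) * (bcol1 a b c d && brow1 a b c d)%:K
  else t + al + z.

Lemma bits_coef_linear a b c d : linear (bits_coef a b c d : _ -> k^o).
Proof.
move=> r; elim/blk_ind=> al g z w v M N t.
elim/blk_ind=> al' g' z' w' v' M' N' t'.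
rewrite blkZ blkD /bits_coef /blk !mxE /GRing.scale /=.
by case: bdet; [ring | case: brk1; ring].
Qed.

(** The sixteen functionals are dual to the sixteen images of matrices, which is a finite check once
    all coefficients are bits. *)
Lemma bits_coef_rep a b c d a' b' c' d' :
  bits_coef a b c d (bits_rep a' b' c' d') =
  [&& a == a', b == b', c == c' & d == d']%:K.
Proof.
(* The constant coordinate [t = 1] must also be presented as a bit for the sums to fold into one
   Boolean. *)
rewrite /bits_coef /bits_rep /blk !mxE /= -[1]/(true%:K).
rewrite -!(natr_andb, natr_addb).
by case: a; case: b; case: c; case: d; case: a'; case: b'; case: c'; case: d'.
Qed.

Definition M22_coef (x : block_alg k 2) : monoid_alg k M22 :=
  [ffun m =>
    bits_coef (entry m 0 0) (entry m 0 1) (entry m 1 0) (entry m 1 1) x].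

Lemma M22_lift_coefK : cancel (monoid_alg_lift M22_rep) M22_coef.
Proof.
move=> x; apply/ffunP => m; rewrite ffunE.
pose f : {linear block_alg k 2 -> k^o} := HB.pack
  (bits_coef (entry m 0 0) (entry m 0 1) (entry m 1 0) (entry m 1 1))
  (GRing.isLinear.Build k _ k^o _ _ (bits_coef_linear _ _ _ _)).
transitivity (f (monoid_alg_lift M22_rep x)) => [//|].
rewrite linear_sum; under eq_bigr do rewrite linearZ.
transitivity (\sum_n x n * (n == m)%:R); last first.
  rewrite (bigD1 m) //= eqxx mulr1 big1 ?addr0 // => n /negPf->.
  by rewrite mulr0.
apply: eq_bigr => n _; congr (_ * _); rewrite [LHS]bits_coef_rep.
congr ((nat_of_bool _)%:R); apply/and4P/eqP => [[]|->]; last by rewrite !eqxx.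
by do 4!move=> /eqP ?; apply/esym/entry_inj.
Qed.

Theorem M22_alg_iso : alg_iso (monoid_alg k M22) (block_alg k 2).
Proof.
apply: (@alg_isoI _ _ _ (monoid_alg_lift M22_rep)).
- exact: monoid_alg_lift_linear.
- exact: monoid_alg_lift_morph M22_rep1 M22_repM.
(* Both sides have dimension 16 = 1 + 1 + 1 + 2 + 2 + 4 + 4 + 1. *)
apply: (@dim_inj_bij k {ffun M22 -> k^o}
  (k^o * k^o * k^o * 'rV[k]_2 * 'cV[k]_2 * 'M[k]_2 * 'M[k]_2 * k^o)%type).
- by move=> c x y; exact: (monoid_alg_lift_linear M22_rep c x y).
- by rewrite /dim /= card_mx card_Fp.
exact: can_inj M22_lift_coefK.
Qed.

End Representation.

(** * Primitive idempotents of the block algebra *)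

Lemma basic_idem_morph (k : fieldType) (A B : algType k)
    (f : {lrmorphism A -> B}) e :
  bijective f -> basic_idem e -> basic_idem (f e).
Proof.
move=> bf [s [t [eps [[ts sum_eps peps oeps] [ceps feps ->]]]]].
have [g fK gK] := lrmorphism_inv bf.
exists s, t, (f \o eps); split; split=> //=.
- by rewrite -rmorph_sum sum_eps rmorph1.
- by move=> i; apply: primitive_idem_morph.
- by move=> i j ij; rewrite -rmorphM oeps ?rmorph0.
- move=> i j it jt /(conj_idem_morph g); rewrite /= !fK; exact: ceps.
- move=> h ph; have [i it ci] := feps _ (primitive_idem_morph (f := g)
    (Bijective gK fK) ph).
  by exists i => //; have := conj_idem_morph f ci; rewrite gK.
by rewrite rmorph_sum.
Qed.

Section BlockIdempotents.
Variables (k : fieldType) (n : nat).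
Implicit Types x y : block_alg k n.

Definition blk_a x : k := x.1.1.1.1.1.1.1.
Definition blk_M x : 'M[k]_n := x.1.1.2.
Definition blk_N x : 'M[k]_n := x.1.2.
Definition blk_t x : k := x.2.

Lemma blk_aM x y : blk_a (x * y) = blk_a x * blk_a y.
Proof. by elim/blk_ind: x => ? ? ? ? ? ? ? ?; elim/blk_ind: y. Qed.
Lemma blk_MM x y : blk_M (x * y) = blk_M x *m blk_M y.
Proof. by elim/blk_ind: x => ? ? ? ? ? ? ? ?; elim/blk_ind: y. Qed.
Lemma blk_NM x y : blk_N (x * y) = blk_N x *m blk_N y.
Proof. by elim/blk_ind: x => ? ? ? ? ? ? ? ?; elim/blk_ind: y. Qed.
Lemma blk_tM x y : blk_t (x * y) = blk_t x * blk_t y.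
Proof. by elim/blk_ind: x => ? ? ? ? ? ? ? ?; elim/blk_ind: y. Qed.

Definition blk_diag (a : k) (M N : 'M[k]_n) (t : k) := blk a 0 0 0 0 M N t.

Lemma blk_diagM (a a' : k) (M M' N N' : 'M[k]_n) (t t' : k) :
  blk_diag a M N t * blk_diag a' M' N' t' =
  blk_diag (a * a') (M *m M') (N *m N') (t * t').
Proof.
by rewrite blkM /blk_diag
  !(mulr0, mul0r, mulmx0, mul0mx, dot0l, scaler0, addr0).
Qed.

Lemma blk_diagD (a a' : k) (M M' N N' : 'M[k]_n) (t t' : k) :
  blk_diag a M N t + blk_diag a' M' N' t' =
  blk_diag (a + a') (M + M') (N + N') (t + t').
Proof. by rewrite blkD !addr0. Qed.

Lemma blk_diag_inj (a a' : k) (M M' N N' : 'M[k]_n) (t t' : k) :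
  blk_diag a M N t = blk_diag a' M' N' t' ->
  [/\ a = a', M = M', N = N' & t = t'].
Proof. by case. Qed.

(** The coordinates [g], [z], [w], [v] span the radical; this endomorphism kills it and splits the
    semisimple quotient. *)
Definition blk_ss x := blk_diag (blk_a x) (blk_M x) (blk_N x) (blk_t x).

Lemma blk_ssM x y : blk_ss (x * y) = blk_ss x * blk_ss y.
Proof. by rewrite blk_diagM /blk_ss blk_aM blk_MM blk_NM blk_tM. Qed.

Lemma blk_ssD x y : blk_ss (x + y) = blk_ss x + blk_ss y.
Proof.
elim/blk_ind: x => ? ? ? ? ? ? ? ?; elim/blk_ind: y => ? ? ? ? ? ? ? ?.
by rewrite [in LHS]blkD /blk_ss /blk_diag blkD !addr0.
Qed.

Lemma blk_ssB x y : blk_ss (x - y) = blk_ss x - blk_ss y.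
Proof. by apply: (addIr (blk_ss y)); rewrite -blk_ssD !subrK. Qed.

Lemma blk_ss1 : blk_ss 1 = 1. Proof. by []. Qed.

Lemma blk_ssK x : blk_ss (blk_ss x) = blk_ss x. Proof. by []. Qed.

(** Writing [x = 1 + r], the only nonzero coordinate of [r^2] is [z = w v], and [r^3 = 0]. The
    inverse used is [1 - r + r^2]. *)
Lemma blk_ss_unit x : blk_ss x = 1 -> exists2 y, x * y = 1 & y * x = 1.
Proof.
elim/blk_ind: x => a g z w v M N t /blk_diag_inj[].
rewrite /blk_a /blk_M /blk_N /blk_t /= => -> -> -> ->.
exists (blk 1 (- g) (dot w v - z) (- w) (- v) 1%:M 1%:M 1).
all: rewrite blkM -[RHS]/(blk 1 0 0 0 0 1%:M 1%:M 1); apply: blk_eq;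
  rewrite ?(mulr1, mulmx1, mul1mx, scale1r) ?(subrr, addNr) //.
- by rewrite mul1r addNr.
- by rewrite mul1r -[- v]scaleN1r dotZr; ring.
- by rewrite mul1r subrr.
- by rewrite mul1r -[- w]scaleN1r dotZl; ring.
Qed.

(* The element [w] intertwines [x] with its semisimple part [s], and it is
   unipotent since its own semisimple part is [s s + (1 - s) (1 - s) = 1]. *)
Lemma conj_blk_ss x : x * x = x -> conj_idem x (blk_ss x).
Proof.
move=> xx; set s := blk_ss x.
have ss : s * s = s by rewrite -blk_ssM xx.
pose w := s * x + (1 - s) * (1 - x).
have [|w' ww' w'w] := @blk_ss_unit w.
  rewrite blk_ssD !blk_ssM !blk_ssB blk_ss1 blk_ssK -/s ss.
  by rewrite mulrBr mulr1 mulrBl mul1r ss subrr subr0 addrC subrK.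
exists w, w'; split=> //.
have -> : w * x = s * w.
  rewrite /w [LHS]mulrDl -!mulrA [X in _ + _ * X = _]mulrBl mul1r xx.
  rewrite subrr mulr0 addr0 [RHS]mulrDr !mulrA ss [X in _ + X * _]mulrBr.
  by rewrite mulr1 ss subrr mul0r addr0.
by rewrite -mulrA ww' mulr1.
Qed.

Lemma idem_field (a : k) : a * a = a -> a = 0 \/ a = 1.
Proof.
move/eqP; rewrite -subr_eq0 -{3}[a]mulr1 -mulrBr mulf_eq0 subr_eq0.
by case/orP=> /eqP; [left | right].
Qed.

(** The corner of the matrix algebra at a diagonal unit consists of the scalar multiples of that
    unit. *)
Lemma idem_delta i (X : 'M[k]_n) : X *m X = X -> delta_mx i i *m X = X ->
  X *m delta_mx i i = X -> X = 0 \/ X = delta_mx i i.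
Proof.
move=> XX dX Xd.
have defX : X = X i i *: delta_mx i i.
  apply/matrixP => p q; rewrite !mxE.
  have [->|pi] := eqVneq p i; last first.
    rewrite mulr0 -dX mxE big1 // => l _.
    by rewrite mxE (negPf pi) mul0r.
  have [->|qi] := eqVneq q i; first by rewrite mulr1.
  rewrite mulr0 -Xd mxE big1 // => l _.
  by rewrite mxE (negPf qi) andbF mulr0.
have : X i i * X i i = X i i.
  have /matrixP/(_ i i) := XX.
  by rewrite {1 2}defX -scalemxAl -scalemxAr mul_delta_mx !mxE !eqxx mulr1.
by case/idem_field => Xii; rewrite defX Xii ?scale0r ?scale1r; [left | right].
Qed.

(** The corner here is the local algebra of triples [(a, g, z)], in which the elements with [a = 0]
    multiply to 0; its only idempotents are 0 and 1. *)
Lemma primitive_blk_a : primitive_idem (blk_diag 1 0 0 0).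
Proof.
apply: primitive_idemI.
- by apply/eqP=> /(congr1 blk_a)/eqP; rewrite oner_eq0.
- by rewrite blk_diagM !mul0mx !mulr0 mulr1.
elim/blk_ind=> a g z w v M N t; rewrite !blkM.
rewrite !(mul0r, mulr0, mul0mx, mulmx0, mul1r, mulr1, dot0l, dot0r, scale0r).
rewrite !(scale1r, scaler0, addr0, add0r).
case=> /idem_field aa hg hz hw hv _ _ _ [hv0 hM hN ht] [hw0 _ _ _].
move: hg hz; rewrite -hw0 -hv0 -hM -hN -ht dot0l addr0.
case: aa => ->.
  by rewrite !(mul0r, mulr0, addr0) => <- <-; left.
rewrite !mulr1 !mul1r => /eqP; rewrite -subr_eq0 addrK => /eqP ->.
by move=> /eqP; rewrite -subr_eq0 addrK => /eqP ->; right.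
Qed.

Lemma primitive_blk_M i : primitive_idem (blk_diag 0 (delta_mx i i) 0 0).
Proof.
apply: primitive_idemI.
- apply/eqP=> /(congr1 blk_M)/matrixP/(_ i i)/eqP.
  by rewrite !mxE !eqxx oner_eq0.
- by rewrite blk_diagM mul0mx !mulr0 mul_delta_mx.
elim/blk_ind=> a g z w v M N t; rewrite !blkM.
rewrite !(mul0r, mulr0, mul0mx, mulmx0, mul1r, mulr1, dot0l, dot0r, scale0r).
rewrite !(scaler0, addr0, add0r).
case=> _ _ _ _ _ MM _ _ [ha hg hz hw hv hM hN ht] [_ _ _ _ hv' hM' _ _].
rewrite -ha -hg -hz -hw -hN -ht -hv'.
by case: (idem_delta MM hM hM') => ->; [left | right].
Qed.

Lemma primitive_blk_N i : primitive_idem (blk_diag 0 0 (delta_mx i i) 0).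
Proof.
apply: primitive_idemI.
- apply/eqP=> /(congr1 blk_N)/matrixP/(_ i i)/eqP.
  by rewrite !mxE !eqxx oner_eq0.
- by rewrite blk_diagM mul0mx !mulr0 mul_delta_mx.
elim/blk_ind=> a g z w v M N t; rewrite !blkM.
rewrite !(mul0r, mulr0, mul0mx, mulmx0, mul1r, mulr1, dot0l, dot0r, scale0r).
rewrite !(scaler0, addr0, add0r).
case=> _ _ _ _ _ _ NN _ [ha hg hz hw hv hM hN ht] [_ _ _ _ _ _ hN' _].
rewrite -ha -hg -hz -hw -hM -ht -hv.
by case: (idem_delta NN hN hN') => ->; [left | right].
Qed.

Lemma primitive_blk_t : primitive_idem (blk_diag 0 0 0 1).
Proof.
apply: primitive_idemI.
- by apply/eqP=> /(congr1 blk_t)/eqP; rewrite oner_eq0.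
- by rewrite blk_diagM !mul0mx !mulr0 mulr1.
elim/blk_ind=> a g z w v M N t; rewrite !blkM.
rewrite !(mul0r, mulr0, mul0mx, mulmx0, mul1r, mulr1, dot0l, dot0r, scale0r).
rewrite !(scaler0, addr0, add0r).
case=> _ _ _ _ _ _ _ /idem_field tt [ha hg hz hw hv hM hN] _.
by rewrite -ha -hg -hz -hw -hM -hN -hv; case: tt => ->; [left | right].
Qed.

End BlockIdempotents.

Section Block2.
Variable k : fieldType.

Lemma delta2_mx2 : delta_mx 0 0 = mx2 1 0 0 0 :> 'M[k]_2.
Proof.
by apply/matrixP => i j; rewrite !mxE; case: (i == 0); case: (j == 0).
Qed.

(** A nonzero entry of [M] yields a column [C] and a row [R] of [M], suitably scaled, with
    [R C = 1]. Then [C R] is a nonzero idempotent below [M], so it equals [M]. *)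
Lemma idem_mx2_conj (M : 'M[k]_2) : M != 0 -> M *m M = M ->
  (forall G, G *m G = G -> M *m G = G -> G *m M = G -> G = 0 \/ G = M) ->
  exists U V : 'M_2,
    [/\ U *m V = 1%:M, V *m U = 1%:M & M = U *m delta_mx 0 0 *m V].
Proof.
move=> M0 MM Msub.
have [[i j] /= Mij] : exists p, M p.1 p.2 != 0.
  apply: contrapT => h; case/eqP: M0; apply/matrixP => i j; rewrite mxE.
  by apply: contrapT => /eqP Mij; apply: h; exists (i, j).
pose C := (M i j)^-1 *: col j M; pose R := row i M.
have RC : R *m C = 1%:M.
  rewrite -scalemxAr [_ *m _]mx11_scalar.
  have -> : (R *m col j M) 0 0 = M i j.
    by rewrite -[in RHS]MM !mxE; apply: eq_bigr => l _; rewrite !mxE.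
  by rewrite scale_scalar_mx mulVf.
have MC : M *m C = C by rewrite /C -scalemxAr !colE mulmxA MM.
have RM : R *m M = R by rewrite -row_mul MM.
have [||| G0 | defM] := Msub (C *m R).
- by rewrite mulmxA -(mulmxA C) RC mulmx1.
- by rewrite mulmxA MC.
- by rewrite -mulmxA RM.
- case/eqP: (Mij); move/matrixP/(_ i j): G0.
  by rewrite mxE big_ord1 !mxE (mulVf Mij) mul1r => ->.
(* [U] completes [C] by a vector annihilated by [R]. Its determinant is [R C = 1], so its adjugate
   [V] is its inverse. *)
pose U := mx2 (C 0 0) (- R 0 1) (C 1 0) (R 0 0).
pose V := mx2 (R 0 0) (R 0 1) (- C 1 0) (C 0 0).
have RC1 : R 0 0 * C 0 0 + R 0 1 * C 1 0 = 1.
  by move/matrixP/(_ 0 0): RC; rewrite mulmx2E !mxE.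
have VU : V *m U = 1%:M.
  rewrite mx2_mul mx2_1; congr (mx2 _ _ _ _) => //; rewrite -?RC1; ring.
exists U, V; split=> //; first exact: mulmx1C.
rewrite -defM [in LHS](col2_eta C) [in LHS](row2_eta R) delta2_mx2 !mx2_mul.
apply/matrixP => p q; rewrite mxE big_ord1 !mxE /=.
by case: (p == 0); case: (q == 0); ring.
Qed.

(** The order matters: the first four represent the conjugacy classes, the last two complete them to
    a decomposition of 1. *)
Definition block_idems : seq (block_alg k 2) :=
  [:: blk_diag 1 0 0 0; blk_diag 0 (delta_mx 0 0) 0 0;
      blk_diag 0 0 (delta_mx 0 0) 0; blk_diag 0 0 0 1;
      blk_diag 0 (delta_mx 1 1) 0 0; blk_diag 0 0 (delta_mx 1 1) 0].

(** [f] is conjugate to its semisimple part, which is again primitive. In a product of algebras such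
    an idempotent is supported in one factor: its component in any factor where it is nonzero is an
    idempotent below it, hence all of it. *)
Lemma primitive_block_conj (f : block_alg k 2) : primitive_idem f ->
  exists2 i, (i < 4)%N & conj_idem block_idems`_i f.
Proof.
move=> pf; have [_ ff _] := pf.
have cf := conj_blk_ss ff; have ps := conj_primitive_idem cf pf.
suff [i i4 ci] : exists2 i, (i < 4)%N & conj_idem block_idems`_i (blk_ss f).
  by exists i => //; apply: conj_idem_trans ci (conj_idem_sym cf).
have := ps; have [s0 ss _] := ps.
move: s0 ss; rewrite {}/blk_ss.
move: (blk_a f) (blk_M f) (blk_N f) (blk_t f) => a M N t {ff pf cf ps f}.
move=> s0; rewrite blk_diagM => /blk_diag_inj[aa MM NN tt] ps.
have [a0|a0] := eqVneq a 0; last first.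
  have [||| /(congr1 (@blk_a _ _)) h | <-] :=
    primitive_idem_sub (x := blk_diag a 0 0 0) ps.
  - by rewrite !blk_diagM !(mul0mx, mulmx0, mulr0, mul0r) aa.
  - by rewrite !blk_diagM !(mul0mx, mulmx0, mulr0, mul0r) aa.
  - by rewrite !blk_diagM !(mul0mx, mulmx0, mulr0, mul0r) aa.
  - by case/eqP: a0.
  exists 0%N => //=; case: (idem_field aa) => a1; last first.
    by rewrite a1; apply: conj_idem_refl.
  by case/eqP: a0.
have [t0|t0] := eqVneq t 0; last first.
  have [||| /(congr1 (@blk_t _ _)) h | <-] :=
    primitive_idem_sub (x := blk_diag 0 0 0 t) ps.
  - by rewrite !blk_diagM !(mul0mx, mulmx0, mulr0, mul0r) tt.
  - by rewrite !blk_diagM !(mul0mx, mulmx0, mulr0, mul0r) tt.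
  - by rewrite !blk_diagM !(mul0mx, mulmx0, mulr0, mul0r) tt.
  - by case/eqP: t0.
  exists 3%N => //=; case: (idem_field tt) => t1; last first.
    by rewrite t1; apply: conj_idem_refl.
  by case/eqP: t0.
have [M0|M0] := eqVneq M 0; last first.
  have [||| /(congr1 (@blk_M _ _)) h | def_s] :=
    primitive_idem_sub (x := blk_diag 0 M 0 0) ps.
  - by rewrite !blk_diagM !(mul0mx, mulmx0, mulr0, mul0r) MM.
  - by rewrite !blk_diagM !(mul0mx, mulmx0, mulr0, mul0r) MM.
  - by rewrite !blk_diagM !(mul0mx, mulmx0, mulr0, mul0r) MM.
  - by case/eqP: M0.
  (* Primitivity in the block algebra passes to the matrix factor, and the conjugating matrices
     there are extended by 1 in the other factors. *)
  have [G GG MG GM|U [V [UV VU defM]]] := idem_mx2_conj M0 MM.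
    rewrite -def_s in ps.
    have [|||/blk_diag_inj[]|/blk_diag_inj[]] :=
      primitive_idem_sub (x := blk_diag 0 G 0 0) ps; try by [left | right].
    - by rewrite !blk_diagM !(mul0mx, mulmx0, mulr0, mul0r) GG.
    - by rewrite !blk_diagM !(mul0mx, mulmx0, mulr0, mul0r) MG.
    - by rewrite !blk_diagM !(mul0mx, mulmx0, mulr0, mul0r) GM.
  exists 1%N => //; rewrite -def_s /=.
  exists (blk_diag 1 U 1%:M 1), (blk_diag 1 V 1%:M 1).
  rewrite !blk_diagM !(mul0mx, mulmx0, mulr0, mul0r, mulr1, mulmx1) UV VU.
  by split; rewrite -?defM.
have [N0|N0] := eqVneq N 0; last first.
  have [||| /(congr1 (@blk_N _ _)) h | def_s] :=
    primitive_idem_sub (x := blk_diag 0 0 N 0) ps.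
  - by rewrite !blk_diagM !(mul0mx, mulmx0, mulr0, mul0r) NN.
  - by rewrite !blk_diagM !(mul0mx, mulmx0, mulr0, mul0r) NN.
  - by rewrite !blk_diagM !(mul0mx, mulmx0, mulr0, mul0r) NN.
  - by case/eqP: N0.
  have [G GG MG GM|U [V [UV VU defN]]] := idem_mx2_conj N0 NN.
    rewrite -def_s in ps.
    have [|||/blk_diag_inj[]|/blk_diag_inj[]] :=
      primitive_idem_sub (x := blk_diag 0 0 G 0) ps; try by [left | right].
    - by rewrite !blk_diagM !(mul0mx, mulmx0, mulr0, mul0r) GG.
    - by rewrite !blk_diagM !(mul0mx, mulmx0, mulr0, mul0r) MG.
    - by rewrite !blk_diagM !(mul0mx, mulmx0, mulr0, mul0r) GM.
  exists 2%N => //; rewrite -def_s /=.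
  exists (blk_diag 1 1%:M U 1), (blk_diag 1 1%:M V 1).
  rewrite !blk_diagM !(mul0mx, mulmx0, mulr0, mul0r, mulr1, mulmx1) UV VU.
  by split; rewrite -?defN.
by case/eqP: s0; rewrite a0 t0 M0 N0.
Qed.

End Block2.

(** * The basic idempotent of the block algebra and its corner *)

Section BasicBlock.
Variable k : fieldType.
Local Notation block_idems := (block_idems k).
Local Notation e1 := (delta_mx 0 0 : 'M[k]_2).

Lemma delta2D : delta_mx 0 0 + delta_mx 1 1 = 1%:M :> 'M[k]_2.
Proof.
by apply/matrixP => i j; rewrite !mxE; case: i j => [[|[|]] // ?] [[|[|]] // ?];
  rewrite /= ?addr0 ?add0r.
Qed.

(** A conjugation invariant that tells the four representatives apart. *)
Definition blk_sig n (x : block_alg k n) :=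
  (blk_a x == 0, blk_M x == 0, blk_N x == 0, blk_t x == 0).

Lemma conj_blk_sig n (x y : block_alg k n) :
  conj_idem x y -> blk_sig x = blk_sig y.
Proof.
suff h (z z' : block_alg k n) : conj_idem z z' ->
  [/\ blk_a z == 0 -> blk_a z' == 0,
    blk_M z == 0 -> blk_M z' == 0, blk_N z == 0 -> blk_N z' == 0 &
    blk_t z == 0 -> blk_t z' == 0].
  move=> cxy; have [? ? ? ?] := h _ _ cxy.
  have [? ? ? ?] := h _ _ (conj_idem_sym cxy).
  by rewrite /blk_sig; congr (_, _, _, _); apply/idP/idP.
case=> u [v [_ _ ->]]; rewrite !blk_aM !blk_MM !blk_NM !blk_tM.
by split=> /eqP->; rewrite ?(mulr0, mulmx0) ?(mul0r, mul0mx).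
Qed.

Lemma basic_block : basic_idem (blk_diag 1 e1 e1 1).
Proof.
exists 6%N, 4%N, (fun i => block_idems`_i); split; split=> //.
- rewrite !big_ord_recl big_ord0 /= !blk_diagD.
  by rewrite !(addr0, add0r) delta2D.
- case=> [[|[|[|[|[|[|]]]]]] // ?] /=.
  + exact: primitive_blk_a.
  + exact: primitive_blk_M.
  + exact: primitive_blk_N.
  + exact: primitive_blk_t.
  + exact: primitive_blk_M.
  exact: primitive_blk_N.
- case=> [[|[|[|[|[|[|]]]]]] // ?]; case=> [[|[|[|[|[|[|]]]]]] // ?] //= _;
    by rewrite blk_diagM ?mul_delta_mx_0 // !(mul0mx, mulmx0, mulr0, mul0r).
- have d0 : (e1 == 0) = false.
    by apply/eqP=> /matrixP/(_ 0 0)/eqP; rewrite !mxE oner_eq0.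
  case=> [[|[|[|[|[|[|]]]]]] // ?]; case=> [[|[|[|[|[|[|]]]]]] // ?] //= _ _;
    first [by move=> _; apply: val_inj |
      by move/conj_blk_sig; rewrite /blk_sig /blk_a /blk_M /blk_N /blk_t /=;
        rewrite !eqxx ?d0 ?oner_eq0].
- move=> f /primitive_block_conj[i i4 ci].
  have i6 : (i < 6)%N by apply: leq_trans i4 _.
  by exists (Ordinal i6).
rewrite (big_ord_narrow (_ : 4 <= 6)%N) !big_ord_recl big_ord0 /= !blk_diagD.
by rewrite !(addr0, add0r).
Qed.

Lemma blk_diag_neq0 (a : k) (M N : 'M_2) (t : k) :
  a != 0 -> blk_diag a M N t != 0.
Proof. by apply: contra => /eqP/(congr1 (@blk_a _ _))/eqP. Qed.

Lemma basic_block_idem :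
  blk_diag 1 e1 e1 1 * blk_diag 1 e1 e1 1 = blk_diag 1 e1 e1 1.
Proof. by rewrite blk_diagM mulr1 mul_delta_mx. Qed.

Definition block_nzidem : nzidem (block_alg k 2) :=
  NzIdem basic_block_idem (blk_diag_neq0 _ _ _ (oner_neq0 k)).

(** The basic idempotent misses only the second diagonal unit of each matrix factor, and this unit
    is recovered from the first one by off-diagonal units. These are the data [x], [y] for
    [morita_corner]. *)
Lemma block_full :
  \sum_(i < 2) [:: 1; blk_diag 0 (delta_mx 1 0) (delta_mx 1 0) 0]`_i *
    blk_diag 1 e1 e1 1 *
    [:: 1; blk_diag 0 (delta_mx 0 1) (delta_mx 0 1) 0]`_i = 1.
Proof.
rewrite !big_ord_recl big_ord0 /= mul1r mulr1 !blk_diagM !mul_delta_mx.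
by rewrite addr0 blk_diagD !(mulr0, mul0r, addr0) delta2D.
Qed.

Let r : 'rV[k]_2 := delta_mx 0 0.
Let c : 'cV[k]_2 := delta_mx 0 0.
Let rc : r *m c = 1%:M.
Proof. by rewrite mul_delta_mx; apply/matrixP => i j; rewrite !mxE !ord1. Qed.
Let cr : c *m r = e1. Proof. by rewrite mul_delta_mx. Qed.

(** As [r c = 1] and [c r = e1], compressing with [r] and [c] identifies the corner with blocks of
    size one; [block_expand] is the inverse there. *)
Definition block_shrink (x : block_alg k 2) : block_alg k 1 :=
  let: (a, g, z, w, v, M, N, t) := x in
  blk a g z (w *m c) (r *m v) (r *m M *m c) (r *m N *m c) t.

Definition block_expand (x : block_alg k 1) : block_alg k 2 :=
  let: (a, g, z, w, v, M, N, t) := x in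
  blk a g z (w *m r) (c *m v) (c *m M *m r) (c *m N *m r) t.

Lemma block_shrink_linear : linear block_shrink.
Proof.
move=> d; elim/blk_ind=> a g z w v M N t.
elim/blk_ind=> a' g' z' w' v' M' N' t'.
rewrite blkZ blkD /block_shrink {1 2 3}/blk blkZ blkD.
by apply: blk_eq; rewrite // ?(mulmxDl, mulmxDr) -?(scalemxAl, scalemxAr) //
  -!scalemxAl.
Qed.
HB.instance Definition _ :=
  GRing.isLinear.Build k _ _ _ block_shrink block_shrink_linear.

Let corner_blk (a g z : k) (w : 'rV_2) (v : 'cV_2) (M N : 'M_2) (t : k) :
  blk_diag 1 e1 e1 1 * blk a g z w v M N t * blk_diag 1 e1 e1 1 =
  blk a g z (w *m e1) (e1 *m v) (e1 *m M *m e1) (e1 *m N *m e1) t.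
Proof.
rewrite !blkM !(mul0mx, mulmx0, dot0l, dot0r, scaler0, scale0r, scale1r).
by rewrite !(mulr0, mul0r, mul1r, mulr1, add0r, addr0).
Qed.

Lemma block_corner_iso : alg_iso (corner block_nzidem) (block_alg k 1).
Proof.
apply: (@corner_iso _ _ _ _ block_shrink block_expand) => /=.
- by rewrite mul0mx mulmx0 -cr !mulmxA rc mul1mx rc.
- elim/blk_ind=> a g z w v M N t.
elim/blk_ind=> a' g' z' w' v' M' N' t'.
  rewrite !corner_blk -cr.
  case=> ww vv MM NN; case=> ww' vv' MM' NN'.
  rewrite blkM /block_shrink {1 2 3}/blk blkM; apply: blk_eq => //.
  (* Since [w] lies in the corner, [e1 = c r] may be inserted between [w] and [v']. *)
  + by rewrite -[in LHS]ww /dot !mulmxA.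
  + by rewrite mulmxDl -scalemxAl -[in LHS]ww !mulmxA.
  + by rewrite mulmxDr -scalemxAr -[in LHS]vv' !mulmxA.
  + by rewrite -[in LHS]MM' !mulmxA -(mulmxA _ r c) rc mulmx1.
  by rewrite -[in LHS]NN' !mulmxA -(mulmxA _ r c) rc mulmx1.
- elim/blk_ind=> a g z w v M N t.
  rewrite /block_expand {1 3}/blk corner_blk -cr.
  apply: blk_eq; rewrite // !mulmxA.
  + by rewrite -(mulmxA w) rc mulmx1.
  + by rewrite -(mulmxA c r c) rc mulmx1.
  + by rewrite -(mulmxA c r c) rc mulmx1 -(mulmxA _ r c) rc mulmx1.
  by rewrite -(mulmxA c r c) rc mulmx1 -(mulmxA _ r c) rc mulmx1.
- elim/blk_ind=> a g z w v M N t; rewrite corner_blk -cr.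
  case=> ww vv MM NN; rewrite /block_shrink {1}/blk /block_expand {1}/blk.
  by apply: blk_eq => //; [rewrite -[RHS]ww | rewrite -[RHS]vv |
    rewrite -[RHS]MM | rewrite -[RHS]NN]; rewrite !mulmxA.
elim/blk_ind=> a g z w v M N t.
rewrite /block_expand {1}/blk /block_shrink {1}/blk.
apply: blk_eq; rewrite // ?mulmxA.
- by rewrite -mulmxA rc mulmx1.
- by rewrite rc mul1mx.
- by rewrite rc mul1mx -mulmxA rc mulmx1.
by rewrite rc mul1mx -mulmxA rc mulmx1.
Qed.

End BasicBlock.

(** * The bound quiver algebra *)

Section PathEvaluation.
Variables (k : fieldType) (Q : quiver) (B : algType k).
Variables (E : vertex Q -> B) (X : arrow Q -> B).
Hypothesis EE : forall u v, E u * E v = if u == v then E u else 0.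
Hypothesis sumE : \sum_v E v = 1.
Hypothesis EX : forall a, E (tgt a) * X a = X a.

(** The order is reversed: the arrow traversed first becomes the rightmost factor. *)
Fixpoint word (s : seq (arrow Q)) : B :=
  if s is a :: s' then word s' * X a else 1.

Lemma word_cat s1 s2 : word (s1 ++ s2) = word s2 * word s1.
Proof. by elim: s1 => [|a s1 IH] /=; rewrite ?mulr1 // IH mulrA. Qed.

(** The last factor makes a trivial path evaluate to its vertex idempotent instead of 1. *)
Definition path_eval (p : qpath Q) : B := word (parrows p) * E (psrc p).

Lemma path_eval_tgt p : E (ptgt p) * path_eval p = path_eval p.
Proof.
rewrite /path_eval /ptgt; have := path_walk p.
rewrite -[(path_val p).1]/(psrc p) -[(path_val p).2]/(parrows p).
move: (psrc p) (parrows p) => v s; elim: s v => [|a s IH] v /=.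
  by rewrite mul1r EE eqxx.
case/andP=> _ /IH {}IH; rewrite -{1}EX -!mulrA (mulrA (word s)) mulrA IH.
by rewrite -mulrA (mulrA (E _)) EX.
Qed.

(** The idempotents at the source of [p] and the target of [q] meet in the middle; by orthogonality
    they kill the undefined concatenations. *)
Lemma path_evalM p q : path_eval p * path_eval q =
  if path_comp p q is Some r then path_eval r else 0.
Proof.
rewrite -(path_eval_tgt q) {1}/path_eval -mulrA (mulrA (E (psrc p))) EE.
case pq: (path_comp p q) => [r|]; last first.
  have [eq_pq|_] := eqVneq (psrc p); last by rewrite mul0r mulr0.
  by have [|r] := @path_comp_defined _ p q; rewrite ?pq.
have [tq sr _ ar] := path_comp_Some pq.
rewrite -tq eqxx path_eval_tgt mulrA -word_cat -ar -sr.
by [].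
Qed.

Definition path_hom (x : path_alg k Q) : B := lin_ext path_eval x.

Lemma path_hom_linear : linear path_hom.
Proof. exact: lin_extP. Qed.

Lemma path_hom_pbasis p : path_hom (pbasis k p) = path_eval p.
Proof. by rewrite pbasisE /path_hom lin_extU. Qed.

HB.instance Definition _ :=
  GRing.isLinear.Build k _ B _ path_hom path_hom_linear.

Lemma path_alg_linear_eq (V : lmodType k) (f g : path_alg k Q -> V) :
  linear f -> linear g -> (forall p, f (pbasis k p) = g (pbasis k p)) -> f =1 g.
Proof.
by move=> lf lg fg; apply: malg_linear_eq => // p; rewrite -pbasisE.
Qed.

Lemma path_hom_morph : monoid_morphism path_hom.
Proof.
split=> [|x y].
  rewrite linear_sum -[RHS]sumE; apply: eq_bigr => v _.
  by rewrite /= path_hom_pbasis /path_eval /= mul1r.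
move: x; apply: path_alg_linear_eq => [c x x'|c x x'|p].
- by rewrite mulrDl -scalerAl linearP.
- by rewrite linearP mulrDl -scalerAl.
move: y; apply: path_alg_linear_eq => [c y y'|c y y'|q].
- by rewrite mulrDr -scalerAr linearP.
- by rewrite linearP mulrDr -scalerAr.
rewrite pbasisM !path_hom_pbasis path_evalM /pbasis_mul.
by case: path_comp => [r|]; rewrite ?path_hom_pbasis ?linear0.
Qed.

End PathEvaluation.

Section Paths.
Variables (k : fieldType) (Q : quiver).

Lemma arrM (a b : arrow Q) (p : qpath Q) :
  val p = (src b, [:: b; a]) -> arr k a * arr k b = pbasis k p.
Proof.
move=> pE; have := path_walk p; rewrite -[path_val p]/(val p) pE /=.
case/and3P=> _ /eqP ab _.
rewrite /arr pbasisM /pbasis_mul.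
have [|r -> rE] := @path_comp_defined _ (parrow a) (parrow b).
  by rewrite /ptgt /psrc /= ab.
by congr (pbasis k _); apply: val_inj; rewrite rE pE.
Qed.

Lemma arrM0 (a b : arrow Q) : src a != tgt b -> arr k a * arr k b = 0.
Proof.
move=> ab; rewrite /arr pbasisM /pbasis_mul path_comp_None //.
by rewrite /ptgt /psrc /= eq_sym.
Qed.

(** This reduces membership of a path in an ideal to membership of its word of arrows. *)
Lemma pbasis_word (p : qpath Q) :
  pbasis k p = word (@arr k Q) (parrows p) * pbasis k (ptriv (psrc p)).
Proof.
case: p => -[v s] ps; elim: s v ps => [|a s IH] v ps; rewrite /parrows /=.
  by rewrite mul1r; congr pbasis; apply: val_inj.
have /andP[/eqP av ws] := ps.
have := IH (tgt a) ws; rewrite /parrows /psrc /=.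
set p' := QPath _ => IHa.
have -> : pbasis k (QPath ps) = pbasis k p' * arr k a.
  rewrite /arr pbasisM /pbasis_mul.
  have [//|r -> rE] := @path_comp_defined _ p' (parrow a).
  congr (pbasis k _); apply: val_inj.
  by rewrite rE -[psrc (parrow a)]/(src a) av.
rewrite IHa -!mulrA; congr (_ * _).
rewrite /arr !pbasisM /pbasis_mul path_comp_trivl path_comp_trivr /= !eqxx.
by rewrite -[psrc (parrow a)]/(src a) av eqxx.
Qed.

End Paths.

Section Quiver22.
Variable k : fieldType.
Local Notation I := (I22 k).
Local Notation arr := (@arr k Q22).
Local Notation al := (alpha : arrow Q22).
Local Notation be := (beta : arrow Q22).
Local Notation ga := (gamma : arrow Q22).
Local Notation B := (block_alg k 1).

Lemma I22_two_sided : two_sided I. Proof. exact: ideal_two_sided. Qed.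

(** Of the nine products of two arrows, four are undefined and hence 0, four are relations, and only
    [be al] remains. *)
Lemma I22_arrM (a b : arrow Q22) : ~ (a = be /\ b = al) -> I (arr a * arr b).
Proof.
have [I0 _ _ _] := I22_two_sided.
case: a b => -[] //= ab; try by rewrite arrM0.
- by move=> J _; apply; apply: Or41.
- by move=> J _; apply; apply: Or44.
- by case: ab.
- by move=> J _; apply; apply: Or42.
by move=> J _; apply; apply: Or43; rewrite expr2.
Qed.

Lemma I22_word (s : seq (arrow Q22)) :
  (1 < size s)%N -> s <> [:: al; be] -> I (word arr s).
Proof.
have [_ _ Il Ir] := I22_two_sided.
case: s => [|a [|b s]] //= _ nab.
have [[bE aE]|ab] := pselect (b = be /\ a = al); last first.
  by rewrite -mulrA; exact: (Il _ _ (I22_arrM ab)).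
case: s nab => [|c s] nab; first by rewrite bE aE in nab.
(* A word starting with [al], [be] has a third arrow [c], and the product [c be] always lies in
   [I]. *)
have cb : ~ (c = be /\ be = al) by case.
by rewrite /= bE -(mulrA (word arr s)); exact: (Ir _ _ (Il _ _ (I22_arrM cb))).
Qed.

Definition E22 (v : vertex Q22) : B :=
  match (v : Qvertex) with
  | v1 => blk_diag 1 0 0 0
  | v2 => blk_diag 0 1%:M 0 0
  | v3 => blk_diag 0 0 1%:M 0
  | v4 => blk_diag 0 0 0 1
  end.

Definition X22 (a : arrow Q22) : B :=
  match (a : Qarrow) with
  | alpha => blk 0 0 0 0 1%:M 0 0 0
  | beta => blk 0 0 0 1%:M 0 0 0 0
  | gamma => blk 0 1 0 0 0 0 0 0
  end.

Lemma E22M u v : E22 u * E22 v = if u == v then E22 u else 0.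
Proof.
by case: u v => -[]; rewrite /= blk_diagM ?(mul0mx, mulmx0, mulr0, mul0r) ?mulr1
  ?mulmx1.
Qed.

Lemma sum_Qvertex (V : nmodType) (F : vertex Q22 -> V) :
  \sum_v F v = F v1 + F v2 + F v3 + F v4.
Proof.
rewrite -!addrA -[RHS]addr0 -!addrA.
rewrite (bigD1 (v1 : vertex Q22)) //= (bigD1 (v2 : vertex Q22)) //=.
rewrite (bigD1 (v3 : vertex Q22)) //= (bigD1 (v4 : vertex Q22)) //=.
by rewrite big1 //; case.
Qed.

Lemma sum_E22 : \sum_v E22 v = 1.
Proof.
by rewrite sum_Qvertex /= !blk_diagD !(addr0, add0r).
Qed.

Lemma X22_src a : X22 a * E22 (src a) = X22 a.
Proof.
by case: a; rewrite /= blkM !(mulr0, mul0r, mulr1, mulmx0, mul0mx, dot0l, dot0r,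
  scaler0, scale0r, scale1r, add0r, addr0, mulmx1).
Qed.

Lemma X22_tgt a : E22 (tgt a) * X22 a = X22 a.
Proof.
by case: a; rewrite /= blkM !(mulr0, mul0r, mulr1, mulmx0, mul0mx, dot0l, dot0r,
  scaler0, scale0r, scale1r, add0r, addr0, mulmx1).
Qed.

Definition phi22 : path_alg k Q22 -> B := path_hom E22 X22.

Lemma phi22_linear : linear phi22. Proof. exact: path_hom_linear. Qed.
HB.instance Definition _ := GRing.isLinear.Build k _ B _ phi22 phi22_linear.

Lemma phi22_morph : monoid_morphism phi22.
Proof.
exact: path_hom_morph E22M sum_E22 X22_tgt.
Qed.
HB.instance Definition _ := GRing.isMonoidMorphism.Build _ B phi22 phi22_morph.

Lemma phi22D x y : phi22 (x + y) = phi22 x + phi22 y.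
Proof. exact: linearD. Qed.
Lemma phi22Z c x : phi22 (c *: x) = c *: phi22 x.
Proof. exact: linearZ. Qed.
Lemma phi22M x y : phi22 (x * y) = phi22 x * phi22 y.
Proof. exact: rmorphM. Qed.

Lemma phi22_triv v : phi22 (pbasis k (ptriv v)) = E22 v.
Proof. by rewrite /phi22 path_hom_pbasis /path_eval /= mul1r. Qed.

Lemma phi22_arr a : phi22 (arr a) = X22 a.
Proof. by rewrite /phi22 path_hom_pbasis /path_eval /= mul1r X22_src. Qed.

Lemma X22M0 a b : ~ (a = be /\ b = al) -> X22 a * X22 b = 0.
Proof.
case: a b => -[] ab; rewrite /= blkM !(mulr0, mul0r, mulr1, mulmx0, mul0mx,
  dot0l, dot0r, scaler0, scale0r, scale1r, add0r, addr0, mulmx1) //.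
by case: ab.
Qed.

Lemma X22_word (s : seq (arrow Q22)) :
  (1 < size s)%N -> s <> [:: al; be] -> word X22 s = 0.
Proof.
case: s => [|a [|b s]] //= _ nab.
have [[bE aE]|ab] := pselect (b = be /\ a = al); last first.
  by rewrite -mulrA (X22M0 ab) mulr0.
case: s nab => [|c s] nab; first by rewrite bE aE in nab.
by rewrite /= bE -(mulrA (word _ _)) X22M0 ?(mulr0, mul0r) // => -[].
Qed.

Lemma I22_phi22 x : I x -> phi22 x = 0.
Proof.
(* By definition [I] lies in every ideal containing the relations, in particular in the kernel of
   [phi22]. *)
move=> Ix; apply: (Ix (fun x => phi22 x = 0)).
  split=> [|y z hy hz|y z hz|y z hz]; first exact: linear0.
  - by rewrite phi22D hy hz addr0.
  - by rewrite phi22M hz mulr0.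
  - by rewrite phi22M hz mul0r.
by move=> y; case=> ->; rewrite ?expr2 phi22M !phi22_arr; apply: X22M0 => -[].
Qed.

(** A linear section of [phi22], multiplicative only modulo [I]: for instance the square of [ga] is
    not 0 in the path algebra. *)
Definition psi22 (x : B) : path_alg k Q22 :=
  let: (a, g, z, w, v, M, N, t) := x in
  a *: pbasis k (ptriv (v1 : vertex Q22)) + g *: arr ga + z *: (arr be * arr al)
  + w 0 0 *: arr be + v 0 0 *: arr al
  + M 0 0 *: pbasis k (ptriv (v2 : vertex Q22))
  + N 0 0 *: pbasis k (ptriv (v3 : vertex Q22))
  + t *: pbasis k (ptriv (v4 : vertex Q22)).

Lemma psi22_blk (a g z : k) (w : 'rV_1) (v : 'cV_1) (M N : 'M_1) (t : k) :
  psi22 (blk a g z w v M N t) =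
  a *: pbasis k (ptriv (v1 : vertex Q22)) + g *: arr ga + z *: (arr be * arr al)
  + w 0 0 *: arr be + v 0 0 *: arr al
  + M 0 0 *: pbasis k (ptriv (v2 : vertex Q22))
  + N 0 0 *: pbasis k (ptriv (v3 : vertex Q22))
  + t *: pbasis k (ptriv (v4 : vertex Q22)).
Proof. by []. Qed.

Lemma psi22_linear : linear psi22.
Proof.
move=> c; elim/blk_ind=> a g z w v M N t.
elim/blk_ind=> a' g' z' w' v' M' N' t'.
have comb (V : lmodType k) (x x' y y' : V) :
    c *: (x + y) + (x' + y') = (c *: x + x') + (c *: y + y').
  by rewrite scalerDr addrACA.
by rewrite blkZ blkD !psi22_blk !mxE !comb !scalerA -!scalerDl.
Qed.
HB.instance Definition _ := GRing.isLinear.Build k B _ _ psi22 psi22_linear.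

Lemma blk_split (a g z : k) (w : 'rV_1) (v : 'cV_1) (M N : 'M_1) (t : k) :
  blk a g z w v M N t = blk a 0 0 0 0 0 0 0 + blk 0 g 0 0 0 0 0 0
    + blk 0 0 z 0 0 0 0 0 + blk 0 0 0 w 0 0 0 0 + blk 0 0 0 0 v 0 0 0
    + blk 0 0 0 0 0 M 0 0 + blk 0 0 0 0 0 0 N 0 + blk 0 0 0 0 0 0 0 t.
Proof. by rewrite !blkD !(addr0, add0r). Qed.

Lemma X22_be_al : X22 be * X22 al = blk 0 0 1 0 0 0 0 0.
Proof.
rewrite /= blkM !(mulr0, mul0r, mulmx0, mul0mx, scaler0, scale0r, addr0, add0r).
by rewrite /dot mulmx1 mxE.
Qed.

Lemma psi22K : cancel psi22 phi22.
Proof.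
elim/blk_ind=> a g z w v M N t; rewrite [RHS]blk_split psi22_blk.
have mx1 (A : 'M[k]_1) : A 0 0 *: 1%:M = A.
  by rewrite scale_scalar_mx mulr1 -mx11_scalar.
rewrite !phi22D !phi22Z phi22M !phi22_arr X22_be_al !phi22_triv.
rewrite /E22 /X22 /blk_diag !blkZ !mx1 !mulr1 !mulr0 !scaler0.
reflexivity.
Qed.

Lemma psi22_E22 v : psi22 (E22 v) = pbasis k (ptriv v).
Proof.
by case: v; rewrite /E22 /blk_diag psi22_blk ?mxE ?eqxx !scale0r ?scale1r
  ?add0r ?addr0.
Qed.

Lemma psi22_X22 a : psi22 (X22 a) = arr a.
Proof.
by case: a; rewrite /X22 psi22_blk ?mxE ?eqxx !scale0r ?scale1r ?add0r ?addr0.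
Qed.

Lemma psi22_be_al : psi22 (X22 be * X22 al) = arr be * arr al.
Proof. by rewrite X22_be_al psi22_blk ?mxE !scale0r scale1r ?add0r ?addr0. Qed.

(** Trivial paths, arrows and [be al] return to themselves; any other path lies in [I] and is killed
    by [phi22]. *)
Lemma I22_pbasis p : I (pbasis k p - psi22 (phi22 (pbasis k p))).
Proof.
have [I0 _ _ Ir] := I22_two_sided.
have Ieq x y : x = y -> I (x - y) by move=> ->; rewrite subrr.
have pE : val p = (psrc p, parrows p) by apply: surjective_pairing.
have := path_walk p; rewrite -[path_val p]/(val p) pE.
have [sE _|[a sE]|s2] : [\/ parrows p = [::], exists a, parrows p = [:: a] |
    (1 < size (parrows p))%N].
- by case: (parrows p) => [|a [|b s]];
    [apply: Or31 | apply: Or32; exists a | apply: Or33].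
- have -> : p = ptriv (psrc p) by apply: val_inj; rewrite pE sE.
  by apply: Ieq; rewrite phi22_triv psi22_E22.
- rewrite sE /= andbT => /eqP av.
  have -> : p = parrow a by apply: val_inj; rewrite pE sE -av.
  by apply: Ieq; rewrite -/(arr a) phi22_arr psi22_X22.
have [sE|s_ne] := pselect (parrows p = [:: al; be]).
  rewrite sE => /= /andP[/eqP av _].
  rewrite -(@arrM _ _ be al p); last by rewrite pE sE -av.
  by apply: Ieq; rewrite phi22M !phi22_arr psi22_be_al.
move=> _; rewrite /phi22 path_hom_pbasis /path_eval X22_word // mul0r linear0.
by rewrite subr0 pbasis_word; exact: (Ir _ _ (I22_word s2 s_ne)).
Qed.

Lemma phi22K (x : path_alg k Q22) : quot_pi I (psi22 (phi22 x)) = quot_pi I x.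
Proof.
move: x; apply: path_alg_linear_eq => [c x y|c x y|p].
- by rewrite phi22D phi22Z linearP linearP.
- by rewrite linearP.
by apply/esym/quot_piP; exact: (I22_pbasis p).
Qed.

(** The morphism starts from the block algebra, so that only its inverse has to choose
    representatives of classes. *)
Theorem quot22_iso : alg_iso B (quot_alg I).
Proof.
apply: (@alg_isoI _ _ _ (fun x => quot_pi I (psi22 x))).
- by move=> c x y; rewrite !linearP.
- split=> [|x y].
    by rewrite -(rmorph1 phi22) phi22K rmorph1.
  (* The product [x y] is the image under [phi22] of the product of the sections, so [phi22K]
     compares the two modulo [I]. *)
  by rewrite -[in LHS](psi22K x) -[in LHS](psi22K y) -phi22M phi22K rmorphM.
exists (fun q => phi22 (sval (quot_pi_surj q))) => [x|q].
  apply/eqP; rewrite -subr_eq0 -[X in _ - X](psi22K x) -linearB; apply/eqP.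
  by apply: I22_phi22; apply/quot_piP; case: quot_pi_surj.
by rewrite phi22K; case: quot_pi_surj.
Qed.

End Quiver22.

(** * Admissibility and the string conditions *)

Section String22.
Variable k : fieldType.
Local Notation I := (I22 k).
Local Notation arr := (@arr k Q22).
Local Notation al := (alpha : arrow Q22).
Local Notation be := (beta : arrow Q22).
Local Notation ga := (gamma : arrow Q22).

Lemma gen_ideal_sub (A : nzRingType) (S J : A -> Prop) x :
  two_sided J -> (forall s, S s -> J s) -> gen_ideal S x -> J x.
Proof. by move=> tJ SJ; apply. Qed.

Lemma gen_ideal_gen (A : nzRingType) (S : A -> Prop) s : S s -> gen_ideal S s.
Proof. by move=> Ss J _; apply. Qed.

Lemma arrM_pbasis (Q : quiver) (a b : arrow Q) : src a = tgt b ->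
  exists2 p : qpath Q, plen p = 2 &
    @Defs.arr k Q a * @Defs.arr k Q b = pbasis k p.
Proof.
move=> ab; have w : walk (src b, [:: b; a]).1 (src b, [:: b; a]).2.
  by rewrite /= ab !eqxx.
by exists (QPath w) => //; apply: arrM.
Qed.

Lemma relations_pbasis x : relations x ->
  exists2 p : qpath Q22, plen p = 2 & x = pbasis k p.
Proof. by case=> ->; rewrite ?expr2; apply: arrM_pbasis. Qed.

Lemma string_ideal_I22 : string_ideal I.
Proof.
(* As [be al] is the only product of two arrows outside [I], both uniqueness conditions on arrows
   follow. *)
have bad d e : ~ I (arr e * arr d) -> e = be /\ d = al.
  by move=> nI; apply: contrapT => ed; apply: nI; exact: (I22_arrM ed).
have [_ _ _ Ir] := I22_two_sided k.
split.
- split.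
    move=> x; apply: gen_ideal_sub; first exact: gen_two_sided.
    move=> s /relations_pbasis[p p2 ->]; apply: gen_ideal_gen.
    by exists p.
  (* The exponent is 3 because [be al] is a path of length 2 outside the reach of the relations. *)
  exists 3 => // x; apply: (gen_ideal_sub (I22_two_sided k)) => s [p p3 ->].
  rewrite pbasis_word; apply: (Ir _ _ (I22_word _ _)).
    by rewrite -[size _]/(plen p) p3.
  by move=> sE; move: p3; rewrite /plen sE.
- exists (fun p => relations (pbasis k p)) => x; split.
    apply: gen_ideal_sub => [|s rs]; first exact: gen_two_sided.
    have [p _ sE] := relations_pbasis rs.
    by apply: gen_ideal_gen; exists p; rewrite -?sE.
  apply: gen_ideal_sub => [|s [p rp ->]]; first exact: gen_two_sided.
  exact: gen_ideal_gen.
(* The arrows at each vertex are covered by a pair, padded arbitrarily where there are fewer than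
   two. *)
- have sub2 (P : {set arrow Q22}) (a b : arrow Q22) :
      P \subset [set a; b] -> (#|P| <= 2)%N.
    move=> Pab; apply: leq_trans (subset_leq_card Pab) _.
    by rewrite cards2; case: eqP.
  move=> v; split.
    by case: v; [apply: (sub2 _ al ga)|apply: (sub2 _ be be)|
      apply: (sub2 _ be be)|apply: (sub2 _ be be)];
      apply/subsetP => -[]; rewrite !inE.
  by case: v; [apply: (sub2 _ be ga)|apply: (sub2 _ al al)|
    apply: (sub2 _ be be)|apply: (sub2 _ be be)];
    apply/subsetP => -[]; rewrite !inE.
- by move=> d e1 e2 _ /bad[-> _] _ /bad[-> _].
by move=> d e1 e2 _ /bad[_ ->] _ /bad[_ ->].
Qed.

End String22.

(** * Kronecker modules *)

Lemma linear_inj_dim (K : fieldType) (U V : vectType K) (f : U -> V) :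
  linear f -> injective f -> (dim U <= dim V)%N.
Proof.
move=> lf inj_f.
pose F : {linear U -> V} := HB.pack f (GRing.isLinear.Build K U V _ f lf).
have kerF : lker (linfun F) == 0%VS.
  by apply/lker0P => u v; rewrite !lfunE => /inj_f.
rewrite -!dimvf -(@limg_dim_eq _ _ _ (linfun F)) ?(eqP kerF) ?capv0 //.
exact: dimvS (subvf _).
Qed.

Section KroneckerModule.
Variables (k : fieldType) (n : nat).

(** With [mulX], this is the preprojective Kronecker module of dimension vector [(n, n + 1)], on
    polynomials of degree less than [n] and less than [n + 1]. *)
Definition incl (p : {poly_n k}) : {poly_n.+1 k} := npolyp n.+1 (val p).
Definition mulX (p : {poly_n k}) : {poly_n.+1 k} := npolyp n.+1 ('X * val p).

Lemma val_incl p : val (incl p) = val p.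
Proof. by apply: npolypK; apply: leqW; apply: size_npoly. Qed.

Lemma val_mulX p : val (mulX p) = 'X * val p.
Proof.
apply: npolypK; have [->|p0] := eqVneq (val p) 0.
  by rewrite mulr0 size_poly0.
by rewrite mulrC size_mulX // ltnS size_npoly.
Qed.

Lemma incl_linear : linear incl.
Proof. by move=> c p q; apply: val_inj; rewrite /= !val_incl. Qed.
HB.instance Definition _ := GRing.isLinear.Build k _ _ _ incl incl_linear.

Lemma mulX_linear : linear mulX.
Proof.
move=> c p q; apply: val_inj.
by rewrite /= val_mulX linearD linearZ /= !val_mulX mulrDr -scalerAr.
Qed.
HB.instance Definition _ := GRing.isLinear.Build k _ _ _ mulX mulX_linear.

Lemma incl0 : incl 0 = 0.
Proof. exact: (linear0 incl). Qed.
Lemma mulX0 : mulX 0 = 0.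
Proof. exact: (linear0 mulX). Qed.

Local Notation triple := ({poly_n k} * {poly_n k} * {poly_n.+1 k})%type.

(** The first and third summands sit at vertex 1, the second at vertex 2. The arrow [alpha] copies
    the first summand to the second, [beta] is [mulX] into the third and [gamma] is [incl] into the
    third; thus [gamma] and [beta alpha] realize the two Kronecker maps. *)
Definition kron_act (b : block_alg k 1) (x : triple) : triple :=
  let: (a, g, z, w, v, M, N, t) := b in
  (a *: x.1.1, v 0 0 *: x.1.1 + M 0 0 *: x.1.2,
   a *: x.2 + incl (g *: x.1.1) + mulX (w 0 0 *: x.1.2 + z *: x.1.1)).

Lemma triple_eq (p p' q q' : {poly_n k}) (s s' : {poly_n.+1 k}) :
  p = p' -> q = q' -> s = s' -> (p, q, s) = (p', q', s').
Proof. by move=> -> -> ->. Qed.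

Lemma kron_actA b c x : kron_act b (kron_act c x) = kron_act (b * c) x.
Proof.
elim/blk_ind: b => a g z w v M N t; elim/blk_ind: c => a' g' z' w' v' M' N' t'.
rewrite blkM {1 2 3}/blk /kron_act /= /dot !mxE !big_ord1; apply: triple_eq.
- by rewrite scalerA.
- by rewrite !scalerDr !scalerA scalerDl addrA (mulrC a').
apply: val_inj; rewrite /= !(val_incl, val_mulX) /= -!mul_polyC.
rewrite !(rmorphD, rmorphM) /=; ring.
Qed.

Lemma kron_act1 x : kron_act 1 x = x.
Proof.
case: x => -[p q] s.
apply: triple_eq; rewrite /= ?mxE ?scale1r ?scale0r ?add0r //.
by rewrite incl0 mulX0 !addr0.
Qed.

Lemma kron_actDr b x y : kron_act b (x + y) = kron_act b x + kron_act b y.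
Proof.
elim/blk_ind: b => a g z w v M N t; apply: triple_eq => /=.
- by rewrite scalerDr.
- by rewrite !scalerDr addrACA.
apply: val_inj; rewrite /= !(val_incl, val_mulX) /= -!mul_polyC; ring.
Qed.

Lemma kron_actDl b c x : kron_act (b + c) x = kron_act b x + kron_act c x.
Proof.
elim/blk_ind: b => a g z w v M N t; elim/blk_ind: c => a' g' z' w' v' M' N' t'.
rewrite blkD; apply: triple_eq; rewrite /= ?mxE.
- by rewrite scalerDl.
- by rewrite !scalerDl addrACA.
apply: val_inj; rewrite /= !(val_incl, val_mulX) /= -!mul_polyC !rmorphD /=.
by ring.
Qed.

Lemma kron_actZ c x : kron_act c%:A x = c *: x.
Proof.
case: x => -[p q] s; rewrite -[1]/(blk 1 0 0 0 0 1%:M 1%:M 1) blkZ.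
apply: triple_eq; rewrite /= ?mxE ?eqxx ?mulr1 ?mulr0 ?scale0r ?add0r //.
by rewrite incl0 mulX0 !addr0.
Qed.

Section Endomorphism.
Variable f : triple -> triple.
Hypothesis fD : forall x y, f (x + y) = f x + f y.
Hypothesis fact : forall b x, f (kron_act b x) = kron_act b (f x).

Let fZ c x : f (c *: x) = c *: f x.
Proof. by rewrite -!kron_actZ fact. Qed.

Let f0 : f 0 = 0.
Proof. by rewrite -{1}(scale0r (0 : triple)) fZ scale0r. Qed.

Let ea : block_alg k 1 := blk 1 0 0 0 0 0 0 0.
Let eg : block_alg k 1 := blk 0 1 0 0 0 0 0 0.
Let ew : block_alg k 1 := blk 0 0 0 1%:M 0 0 0 0.
Let ev : block_alg k 1 := blk 0 0 0 0 1%:M 0 0 0.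

Let act_ea (x : triple) : kron_act ea x = (x.1.1, 0, x.2).
Proof.
by apply: triple_eq; rewrite /= ?mxE ?eqxx
  ?(scale0r, scale1r, incl0, mulX0, addr0, add0r).
Qed.
Let act_eg (x : triple) : kron_act eg x = (0, 0, incl x.1.1).
Proof.
by apply: triple_eq; rewrite /= ?mxE ?eqxx
  ?(scale0r, scale1r, incl0, mulX0, addr0, add0r).
Qed.
Let act_ew (x : triple) : kron_act ew x = (0, 0, mulX x.1.2).
Proof.
by apply: triple_eq; rewrite /= ?mxE ?eqxx
  ?(scale0r, scale1r, incl0, mulX0, addr0, add0r).
Qed.
Let act_ev (x : triple) : kron_act ev x = (0, x.1.1, 0).
Proof.
by apply: triple_eq; rewrite /= ?mxE ?eqxx
  ?(scale0r, scale1r, incl0, mulX0, addr0, add0r).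
Qed.

(** [P] and [F] are diagonal blocks of [f], and [fQ] shows that the second summand carries [P]
    again. [H] is the only off-diagonal block left. *)
Let F s := (f (0, 0, s)).2.
Let P p := (f (p, 0, 0)).1.1.
Let H p := (f (p, 0, 0)).2.

Let fP p : f (p, 0, 0) = (P p, 0, H p).
Proof.
have := fact ea (p, 0, 0); rewrite !act_ea /= => ->.
by rewrite /P /H; case: (f _) => -[].
Qed.

Let fQ q : f (0, q, 0) = (0, P q, 0).
Proof. by have := fact ev (q, 0, 0); rewrite !act_ev. Qed.

Let fF s : f (0, 0, s) = (0, 0, F s).
Proof.
have := fact ea (0, 0, s); rewrite !act_ea /= => fs.
have f11 : (f (0, 0, s)).1.1 = 0.
  by have := fact ev (0, 0, s); rewrite !act_ev -[f (0, _, 0)]/(f 0) f0 => -[].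
by rewrite fs f11.
Qed.

Let F_incl p : F (incl p) = incl (P p).
Proof. by have := fact eg (p, 0, 0); rewrite !act_eg /= fF => -[]. Qed.

Let F_mulX p : F (mulX p) = mulX (P p).
Proof. by have := fact ew (0, p, 0); rewrite !act_ew /= fF fQ => -[]. Qed.

Let FD s t : F (s + t) = F s + F t.
Proof.
have fst0 : (0, 0, s + t) = (0, 0, s) + (0, 0, t) :> triple.
  by apply: triple_eq; rewrite /= ?addr0.
by rewrite /F fst0 fD.
Qed.

Let FZ c s : F (c *: s) = c *: F s.
Proof.
have fcs : (0, 0, c *: s) = c *: ((0, 0, s) : triple).
  by apply: triple_eq; rewrite /= ?scaler0.
by rewrite /F fcs fZ.
Qed.

(** The pair [(P, F)] commutes with [incl] and [mulX]. Hence $F(X^{i+1}) = X P(X^i) = X F(X^i)$,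
    where [i < n] is needed for $X^i$ to lie in the source. *)
Let F_monomial i : (i <= n)%N ->
  val (F (npolyp n.+1 'X^i)) = 'X^i * val (F (npolyp n.+1 1)).
Proof.
elim: i => [|i IH] i_n; first by rewrite expr0 mul1r.
have valX j m : (j < m)%N -> val (npolyp m 'X^j : {poly_m k}) = 'X^j.
  by move=> jm; apply: npolypK; rewrite size_polyXn.
have inclX : npolyp n.+1 'X^i = incl (npolyp n 'X^i).
  by apply: val_inj; rewrite val_incl !valX // ltnW.
have -> : npolyp n.+1 'X^(i.+1) = mulX (npolyp n 'X^i).
  by apply: val_inj; rewrite val_mulX !valX // exprS.
rewrite F_mulX val_mulX -val_incl -F_incl -inclX IH ?(ltnW i_n) //.
by rewrite mulrA -exprS.
Qed.

(** The endomorphisms of the Kronecker module are scalars: $X^n F(1)$ still has degree at most [n],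
    so $F(1)$ is constant. *)
Let F_scalar : exists l : k, forall s, F s = l *: s.
Proof.
have [l Fl] : exists l : k, val (F (npolyp n.+1 1)) = l%:P.
  exists (val (F (npolyp n.+1 1)))`_0; apply: size1_polyC.
  set c := val _; have [->|c0] := eqVneq c 0; first by rewrite size_poly0.
  have := size_npoly (F (npolyp n.+1 'X^n)).
  have -> : polyn (F (npolyp n.+1 'X^n)) = c * 'X^n.
    by rewrite mulrC; exact: F_monomial (leqnn n).
  by rewrite size_mulXn //; lia.
exists l => s; have := npolyX_full k n.+1 => /coord_basis/(_ (memvf s)) ->.
have F0 : F 0 = 0 by rewrite -{1}(scale0r (0 : {poly_n.+1 k})) FZ scale0r.
rewrite (big_morph F FD F0) scaler_sumr; apply: eq_bigr => i _.
rewrite FZ scalerA mulrC -scalerA; congr (_ *: _).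
have iE : (npolyX k n.+1)`_i = npolyp n.+1 'X^i.
  by rewrite nth_npolyX tnth_mktuple.
have i_n : (i <= n)%N by rewrite -ltnS.
rewrite iE; apply: val_inj; rewrite (F_monomial i_n) Fl mulrC mul_polyC.
have -> : val (l *: npolyp n.+1 'X^i) = l *: val (npolyp n.+1 'X^i) by [].
by congr (_ *: _); rewrite [RHS]npolypK // size_polyXn.
Qed.

(** [f] is a scalar [l] plus the square-zero map [H]. Idempotence gives [l^2 = l] and [2 l H = H],
    so [H = 0] both for [l = 0] and for [l = 1]. *)
Lemma kron_idem_endo : (forall x, f (f x) = f x) ->
  (forall x, f x = 0) \/ (forall x, f x = x).
Proof.
move=> ff; have [l Fl] := F_scalar.
have Pl p : P p = l *: p.
  by apply: val_inj; rewrite /= -[LHS]val_incl -F_incl Fl /= val_incl.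
have fE p q s : f (p, q, s) = (l *: p, l *: q, l *: s + H p).
  have -> : (p, q, s) = (p, 0, 0) + (0, q, 0) + (0, 0, s) :> triple.
    by apply: triple_eq; rewrite /= ?addr0 ?add0r.
  rewrite !fD fP fQ fF !Pl Fl.
  by apply: triple_eq; rewrite /= ?addr0 ?add0r // addrC.
have HZ p : H (l *: p) = l *: H p.
  have := fZ l (p, 0, 0); have -> : l *: ((p, 0, 0) : triple) = (l *: p, 0, 0).
    by apply: triple_eq; rewrite /= ?scaler0.
  by rewrite !fP => -[].
have H0 : H 0 = 0 by rewrite /H f0.
have ll : l * l = l.
  (* The constant 1 of the third summand is nonzero for every [n], whereas the other two summands
     vanish for [n = 0]. *)
  have /(congr1 snd) := ff (0, 0, npolyp n.+1 1).
  rewrite !fE /= !scaler0 H0 !addr0 scalerA.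
  move/(congr1 (fun s : {poly_n.+1 k} => (val s)`_0)).
  by rewrite /= !coefZ coef_npolyp coef1 /= !mulr1.
have Hl p : l *: H p + H (l *: p) = H p.
  have /(congr1 snd) := ff (p, 0, 0).
  by rewrite !fE /= !scaler0 !add0r.
case: (idem_field ll) => l01; [left | right] => -[[p q] s]; rewrite fE l01.
  have := Hl p; rewrite l01 !scale0r H0 addr0 => <-.
  by rewrite addr0.
have := Hl p; rewrite l01 !scale1r => /eqP; rewrite -subr_eq0 addrK => /eqP ->.
by rewrite addr0.
Qed.

End Endomorphism.

End KroneckerModule.

Section KroneckerFamily.
Variables (k : fieldType) (B : algType k).
Variable rho : {lrmorphism B -> block_alg k 1}.

(** The argument [f] tags the type with the morphism along which the action is pulled back, so that
    the [B]-module structure can be inferred from the type. *)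
Definition kron_mod (f : B -> block_alg k 1) (n : nat) : Type :=
  {poly_n k} * {poly_n k} * {poly_n.+1 k}.
HB.instance Definition _ f n := GRing.Zmodule.on (kron_mod f n).

Section Scale.
Variable n : nat.
Implicit Types x y : kron_mod rho n.

Definition kron_scale (b : B) x : kron_mod rho n := kron_act (rho b) x.

Let scaleA b c x : kron_scale b (kron_scale c x) = kron_scale (b * c) x.
Proof. by rewrite /kron_scale kron_actA -rmorphM. Qed.
Let scale1 : left_id 1 kron_scale.
Proof. by move=> x; rewrite /kron_scale rmorph1 kron_act1. Qed.
Let scaleDr : right_distributive kron_scale +%R.
Proof. by move=> b x y; apply: kron_actDr. Qed.
Let scaleDl x : {morph kron_scale^~ x : b c / b + c}.
Proof. by move=> b c; rewrite /kron_scale rmorphD kron_actDl. Qed.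
HB.instance Definition _ := GRing.Zmodule_isLmodule.Build B (kron_mod rho n)
  scaleA scale1 scaleDr scaleDl.

Lemma kron_modZ b x : b *: x = kron_act (rho b) x.
Proof. by []. Qed.

Lemma kron_mod_scalar (c : k) x : (c%:A : B) *: x =
  c *: (x : {poly_n k} * {poly_n k} * {poly_n.+1 k})%type.
Proof. by rewrite kron_modZ rmorph_alg kron_actZ. Qed.

Lemma kron_mod_fin_dim : fin_dim (kron_mod rho n : lmodType B).
Proof.
pose V : vectType k := ({poly_n k} * {poly_n k} * {poly_n.+1 k})%type.
exists (\dim {:V}), (fun i => (vbasis {:V})`_i) => x.
exists (fun i => coord (vbasis {:V}) i (x : V)).
rewrite [LHS](coord_vbasis (memvf (x : V))).
by apply: eq_bigr => i _; rewrite kron_mod_scalar.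
Qed.

Hypothesis rho_surj : forall c, exists b, rho b = c.

(** A decomposition yields the projection [E] onto one factor. By surjectivity of [rho] it commutes
    with the whole block algebra, so it is 0 or the identity and one factor vanishes. *)
Lemma kron_mod_indecomposable : indecomposable (kron_mod rho n : lmodType B).
Proof.
split.
  exists (0, 0, npolyp n.+1 1); apply/eqP=> /(congr1 snd).
  move/(congr1 (fun s : {poly_n.+1 k} => (val s)`_0)).
  by rewrite /= coef_npolyp coef1 coef0 /= => /eqP; rewrite oner_eq0.
move=> U W [f [g fK gK]].
pose E x := g ((f x).1, 0).
have gD u w : g (u + w) = g u + g w by apply: (can_inj fK); rewrite linearD !gK.
have gZ b u : g (b *: u) = b *: g u.
  by apply: (can_inj fK); rewrite linearZ /= !gK.
have Efg u w : E (g (u, w)) = g (u, 0) by rewrite /E gK.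
have [|||E0|E1] := @kron_idem_endo k n E.
- move=> x y; rewrite /E -gD linearD; congr (g (_, _)).
  by rewrite addr0.
- move=> b x; have [c <-] := rho_surj b.
  rewrite -[kron_act _ x]kron_modZ /E linearZ -[RHS]gZ; congr (g (_, _)).
  by rewrite scaler0.
- by move=> x; rewrite /E gK.
- left=> u; have := Efg u 0; rewrite E0 => /(congr1 f).
  by rewrite gK linear0 => -[].
right=> w; have := Efg 0 w; rewrite E1 => /(congr1 f).
by rewrite !gK => -[].
Qed.

End Scale.

(** The dimension over [k] is [3 n + 1], which determines [n]. *)
Lemma kron_mod_dim m n :
  mod_iso (kron_mod rho m : lmodType B) (kron_mod rho n : lmodType B) -> m = n.
Proof.
have le p q (f : {poly_p k} * {poly_p k} * {poly_p.+1 k} ->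
      {poly_q k} * {poly_q k} * {poly_q.+1 k}) :
    linear f -> injective f -> (p <= q)%N.
  move=> lf /(linear_inj_dim lf); rewrite -[leqLHS]/(p + p + p.+1)%N.
  by rewrite -[leqRHS]/(q + q + q.+1)%N; lia.
case=> f [g fK gK].
have lf : linear (f : {poly_m k} * {poly_m k} * {poly_m.+1 k} ->
    {poly_n k} * {poly_n k} * {poly_n.+1 k}).
  by move=> c x y; rewrite -!kron_mod_scalar -linearZ -linearD.
apply/eqP; rewrite eqn_leq (le _ _ _ lf (can_inj fK)) (le _ _ g) //.
  by move=> c x y; apply: (can_inj fK); rewrite lf !gK.
exact: can_inj gK.
Qed.

Theorem infinite_rep_type_surj :
  (forall c, exists b, rho b = c) -> infinite_rep_type B.
Proof.
move=> rho_surj; exists (fun n => kron_mod rho n : lmodType B).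
split=> [n|m n]; last exact: kron_mod_dim.
by split; [exact: kron_mod_fin_dim | exact: kron_mod_indecomposable].
Qed.

End KroneckerFamily.

(** * Transport from the block algebra to the monoid algebra *)

Theorem theorem3p15 (k : fieldType) (char2 : 2%N \in [pchar k]%R) :
  ((exists e : nzidem (monoid_alg k M22), basic_idem (idem_val e)) /\
   (forall e : nzidem (monoid_alg k M22), basic_idem (idem_val e) ->
      alg_iso (corner e) (quot_alg (I22 k)))) /\
  (exists B : algType k,
     [/\ string_algebra B, infinite_rep_type B &
         morita_equivalent (monoid_alg k M22) B]).
Proof.
have [Phi bPhi] := M22_alg_iso char2.
have [g PhiK gK] := lrmorphism_inv bPhi.
have ge0 : g (idem_val (block_nzidem k)) != 0.
  apply/eqP => /(congr1 Phi); rewrite gK rmorph0; apply/eqP.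
  exact: idem_neq0.
have gee : g (idem_val (block_nzidem k)) * g (idem_val (block_nzidem k)) =
    g (idem_val (block_nzidem k)) by rewrite -rmorphM idem_mul.
(* The basic idempotent of the block algebra, pulled back to the monoid algebra; its corner serves
   as the algebra [B] of the last claim. *)
pose e0 := NzIdem gee ge0.
have be0 : basic_idem (idem_val e0).
  exact: basic_idem_morph (Bijective gK PhiK) (basic_block k).
have iso0 : alg_iso (corner e0) (block_alg k 1).
  apply: alg_iso_trans (block_corner_iso k).
  apply: (@corner_iso_corner _ _ _ e0 (block_nzidem k) Phi g) => /=.
  - exact: gK.
  - by move=> a ha; rewrite -[in RHS]ha !rmorphM /= gK.
  - by move=> *; rewrite rmorphM.
  - by move=> b hb; rewrite -[in RHS]hb !rmorphM.
  - by [].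
  - by [].
have iso_quot : alg_iso (corner e0) (quot_alg (I22 k)).
  exact: alg_iso_trans iso0 (quot22_iso k).
split; first split.
- by exists e0.
(* Any other basic idempotent has a corner isomorphic to that of [e0]. *)
- move=> e be; apply: alg_iso_trans iso_quot.
  have [t [b [bb ee]]] := basic_idem_family be.
  have [t0 [b0 [bb0 ee0]]] := basic_idem_family be0.
  exact: basic_corner_iso bb bb0 ee ee0.
exists (corner e0); split.
- exists Q22, (I22 k); split=> //; exact: string_ideal_I22.
- have [rho [rho' _ rhoK]] := iso0.
  by apply: (@infinite_rep_type_surj _ _ rho) => c; exists (rho' c).
(* The witnesses of fullness from [block_full] are pulled back along the isomorphism. *)
apply: (@morita_corner _ _ e0 2
  (fun i => g ([:: 1; blk_diag 0 (delta_mx 1 0) (delta_mx 1 0) 0]`_i))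
  (fun i => g ([:: 1; blk_diag 0 (delta_mx 0 1) (delta_mx 0 1) 0]`_i))).
transitivity (g 1); last exact: rmorph1.
rewrite -[in RHS](block_full k) rmorph_sum; apply: eq_bigr => i _.
by rewrite !rmorphM.
Qed.
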